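(* Let $f:\mathbb{R}^d\to\mathbb{R}$ be a convex quadratic function with $L$-Lipschitz continuous gradient and (constant) Hessian matrix $\mathbf{A}\neq 0$, having a minimizer $\mathbf{x}^*$ with minimum value $f^*$. Let $\rho>0$, $\delta\ge 0$, and let $\{\mathbf{x}_k\}_{k\ge 0}$ be generated by the algorithm $\mathcal{RG}_\rho$ (see context) run with a $\delta$-approximated zeroth-order oracle of $f$ and step sizes $h_k=\frac{1}{12\,\mathrm{tr}(\mathbf{A})}$. Set $$C_1=\frac{5}{16}\mathrm{tr}(\mathbf{A})\,d+\frac{5}{384}\mathrm{tr}(\mathbf{A}),\qquad C_2=\frac{d}{3\,\mathrm{tr}(\mathbf{A})}+\frac{1}{72\,\mathrm{tr}(\mathbf{A})}.$$ Then for every $k\ge 0$, $$(k+1)\big(\mathbb{E} f(\mathbf{x}_{k+1})-f^*\big)\le k\,\mathbb{E}\big(f(\mathbf{x}_k)-f^*\big)+(k+1)\Big(C_1\rho^2+C_2\frac{\delta^2}{\rho^2}\Big)+\frac{12\,\mathrm{tr}(\mathbf{A})}{k+1}\,\mathbb{E}\|\mathbf{x}_k-\mathbf{x}^*\|^2,$$ where the expectation is over all the randomness in the algorithm.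
   Context: A $\delta$-approximated zeroth-order oracle of $f$ returns, for each queried point $\mathbf{x}\in\mathbb{R}^d$, a value $\tilde f(\mathbf{x})$ with $|\tilde f(\mathbf{x})-f(\mathbf{x})|\le\delta$; the error may be adversarial. Algorithm $\mathcal{RG}_\rho$: from a given starting point $\mathbf{x}_0\in\mathbb{R}^d$, at step $k$ draw a fresh standard Gaussian vector $\boldsymbol{\xi}_k\sim N(0,\mathbf{I}_d)$ independent of the past, query the oracle at $\mathbf{x}_k$ and $\mathbf{x}_k+\rho\boldsymbol{\xi}_k$, and set $$\mathbf{x}_{k+1}=\mathbf{x}_k-h_k\,\frac{\tilde f(\mathbf{x}_k+\rho\boldsymbol{\xi}_k)-\tilde f(\mathbf{x}_k)}{\rho}\,\boldsymbol{\xi}_k .$$ *)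

(* Defs.v *)
From HB Require Import structures.
From mathcomp Require Import all_boot all_order all_algebra.
From mathcomp Require Import all_classical all_reals all_analysis.

Set Implicit Arguments.
Unset Strict Implicit.
Unset Printing Implicit Defensive.

Import Order.TTheory GRing.Theory Num.Theory.
Import numFieldNormedType.Exports.

Local Open Scope classical_set_scope.
Local Open Scope ring_scope.

(* Points of R^d are row vectors. The library norm `|x| on matrices is the
   sup norm, hence a separate Euclidean norm. *)
Definition enorm (R : realType) (d : nat) (x : 'rV[R]_d) : R :=
  Num.sqrt (\sum_(i < d) x 0 i ^+ 2).

Definition gradient (R : realType) (d : nat) (f : 'rV[R]_d -> R)
    (x : 'rV[R]_d) : 'rV[R]_d :=
  \row_(i < d) 'D_(delta_mx 0 i) f x.

Definition hessian (R : realType) (d : nat) (f : 'rV[R]_d -> R)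
    (x : 'rV[R]_d) : 'M[R]_d :=
  \matrix_(i < d, j < d) 'D_(delta_mx 0 i) ('D_(delta_mx 0 j) f) x.

Definition lipschitz_gradient (R : realType) (d : nat) (L : R)
    (f : 'rV[R]_d -> R) : Prop :=
  forall x y, enorm (gradient f x - gradient f y) <= L * enorm (x - y).

(* M is not required to be symmetric: the Hessian is then M + M^T. *)
Definition quadratic_function (R : realType) (d : nat)
    (f : 'rV[R]_d -> R) : Prop :=
  exists (M : 'M[R]_d) (b : 'rV[R]_d) (c : R),
    forall x, f x = (x *m M *m x^T) 0 0 + (b *m x^T) 0 0 + c.

Definition independent_systems (disp : measure_display)
    (T : measurableType disp) (R : realType) (P : probability T R)
    (F G : set (set T)) : Prop :=
  forall A B, F A -> G B -> P (A `&` B) = (P A * P B)%E.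

(* Events depending on one coordinate of X: a generating family, not itself a
   sigma-algebra. *)
Definition vector_events (disp : measure_display) (T : measurableType disp)
    (R : realType) (d : nat) (X : T -> 'rV[R]_d) : set (set T) :=
  \bigcup_(i : 'I_d) preimage_set_system [set: T] (fun w => X w 0 i) measurable.

(* The coordinates are independent with law N(0, 1), i.e. X ~ N(0, I_d). *)
Definition standard_gaussian (disp : measure_display) (T : measurableType disp)
    (R : realType) (P : probability T R) (d : nat) (X : T -> 'rV[R]_d) : Prop :=
  (forall i : 'I_d, measurable_fun [set: T] (fun w => X w 0 i)) /\
  forall B : 'I_d -> set R, (forall i, measurable (B i)) ->
    P [set w | forall i, B i (X w 0 i)] =
      (\prod_(i < d) normal_prob (0 : R) 1 (B i))%E.

Definition approx_oracle (R : realType) (d : nat) (delta : R)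
    (f ft : 'rV[R]_d -> R) : Prop :=
  forall x, `|ft x - f x| <= delta.

(* Sigma-algebra of everything observed before step k: the directions drawn
   and the oracle answers y_j, z_j received at the steps j < k. *)
Definition past (disp : measure_display) (T : measurableType disp)
    (R : realType) (d : nat) (xi : nat -> T -> 'rV[R]_d) (y z : nat -> T -> R)
    (k : nat) : set (set T) :=
  <<s \bigcup_(j in [set j : nat | (j < k)%N])
        (vector_events (xi j) `|`
         preimage_set_system [set: T] (y j) measurable `|`
         preimage_set_system [set: T] (z j) measurable) >>.

(* oracle k w v is the value returned during step k for a query at v, in the
   outcome w. The error may thus depend on k, on the whole past, on xi_k, and
   on extra randomness; a fixed function is the special case where
   oracle k w v does not depend on k and w. Only the two answers actually
   received at each step need to be random variables. *)
Record RG_generated (disp : measure_display) (T : measurableType disp)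
    (R : realType) (P : probability T R) (d : nat) (f : 'rV[R]_d -> R)
    (rho delta : R) (h : nat -> R) (x0 : 'rV[R]_d)
    (oracle : nat -> T -> 'rV[R]_d -> R)
    (xi x : nat -> T -> 'rV[R]_d) : Prop := {
  RG_start : forall w, x 0%N w = x0 ;
  RG_step : forall k w,
    x k.+1 w = x k w -
      (h k * ((oracle k w (x k w + rho *: xi k w) - oracle k w (x k w)) / rho))
        *: xi k w ;
  RG_oracle : forall k w, approx_oracle delta f (oracle k w) ;
  RG_answer_base : forall k,
    measurable_fun [set: T] (fun w => oracle k w (x k w)) ;
  RG_answer_shifted : forall k,
    measurable_fun [set: T] (fun w => oracle k w (x k w + rho *: xi k w)) ;
  RG_gaussian : forall k, standard_gaussian P (xi k) ;
  RG_fresh : forall k,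
    independent_systems P
      (past xi (fun j w => oracle j w (x j w))
               (fun j w => oracle j w (x j w + rho *: xi j w)) k)
      <<s vector_events (xi k) >>
}.

(* Main.v *)
(** Write u = x_k - x*, g = A u, t = tr A, h = 1 / (12 t), s = <g, xi> and
    q = xi A xi^T. Since f is exactly quadratic, one step gives
    F' = F - h (s + r) s + h^2 (s + r)^2 q / 2 with F = f - f* and
    r = rho q / 2 + e / rho, |e| <= 2 delta, so that pointwise
    F' <= F + s^2 (h^2 q - 3h/8) + (2h/5 + h^2 q) r^2, whatever the adversarial
    error is. Decomposing A as a sum of rank one matrices b^T b, the Gaussian
    moments E <a, xi>^(2m) = |a|^(2m) (2m-1)!! give E q = t, E q^3 <= 15 t^3 and
    E [<a, xi>^2 q] <= 3 t |a|^2 for fixed a; by independence of xi from the past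
    the last bound may be averaged over the random a = g, and the middle term
    contributes at most - E |g|^2 / (96 t). AM-GM turns that gain into
    F / (k+1) - 12 t |u|^2 / (k+1)^2. If E |u|^2 is infinite the claim is trivial,
    so no integrability of the iterates has to be proved beforehand. *)

Require Import Defs.
From HB Require Import structures.
From mathcomp Require Import all_boot all_order all_algebra.
From mathcomp Require Import all_classical all_reals all_analysis.
From mathcomp Require Import measurable_realfun ring lra.
Import Order.TTheory GRing.Theory Num.Theory.
Import numFieldNormedType.Exports.
Local Open Scope classical_set_scope.
Local Open Scope ring_scope.

Set Implicit Arguments.
Unset Strict Implicit.
Unset Printing Implicit Defensive.

(** * Moments of the standard normal density *)

Section gaussian_moments.
Variable R : realType.
Local Notation mu := lebesgue_measure.
Local Notation phi := (normal_pdf (0 : R) 1).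

Lemma std_normal_pdfE (x : R) :
  phi x = normal_peak 1 * expR (- x ^+ 2 / 2).
Proof. by rewrite normal_pdfE ?oner_neq0// /normal_fun subr0 expr1n. Qed.

Lemma is_derive_std_normal_pdf (x : R) : is_derive x 1 phi (- (x * phi x)).
Proof.
have -> : phi = (fun x => normal_peak 1 * expR (- x ^+ 2 / 2)).
  by apply/funext => y; exact: std_normal_pdfE.
apply: is_derive_eq.
by rewrite !scaler0 /GRing.scale /=; lra.
Qed.

(** For [|x| <= 1] the constant dominates, otherwise the higher power does. The exponent is even so
    that it can be compared with a Taylor term of [expR (x ^+ 2 / 4)]. *)
Lemma normr_exp_le1D (n : nat) (x : R) : `|x| ^+ n <= 1 + x ^+ n.+1.*2.
Proof.
have -> : x ^+ n.+1.*2 = `|x| ^+ n.+1.*2.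
  by rewrite -normrX ger0_norm// exprn_even_ge0// odd_double.
have [x1|/ltW x1] := leP `|x| 1.
  by rewrite (@le_trans _ _ 1)// ?exprn_ile1// lerDl exprn_ge0.
rewrite (@le_trans _ _ (`|x| ^+ n.+1.*2))// ?lerDr// ler_weXn2l// -addnn.
exact: leq_trans (leq_addr _ _).
Qed.

(* Dominating by the density of variance 2 leaves room for any power of x. *)
Lemma moment_pdf_le (n : nat) : exists2 C : R, 0 <= C &
  forall x, `|x ^+ n * phi x| <= C * normal_pdf 0 (Num.sqrt 2) x.
Proof.
have s20 : Num.sqrt 2 != 0 :> R by rewrite gt_eqF// sqrtr_gt0.
have p2 := @normal_peak_gt0 R _ s20.
have p1 := @normal_peak_gt0 R 1 (oner_neq0 _).
(* The factor [4 ^+ n.+1 * n.+1]![comes from]y ^+ n.+1 / n.+1[! <= expR y] at [y = x ^+ 2 / 4]; the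
   quotient of peaks exchanges the two normalizations. *)
exists ((1 + 4 ^+ n.+1 * n.+1`!%:R) * normal_peak 1 / normal_peak (Num.sqrt 2)).
  by rewrite !mulr_ge0 ?invr_ge0 ?(ltW p1) ?(ltW p2)// addr_ge0// mulr_ge0.
move=> x; rewrite normrM normrX (ger0_norm (normal_pdf_ge0 _ _ _)) std_normal_pdfE.
rewrite normal_pdfE// /normal_fun subr0 sqr_sqrtr//.
rewrite [leRHS]mulrA divfK ?gt_eqF//.
(* One half of the exponent is that of the density of variance 2; the other half absorbs the power
   of [x]. *)
rewrite (_ : - x ^+ 2 / 2 = - x ^+ 2 / (2 *+ 2) + - (x ^+ 2 / 4)); last first.
  by rewrite -mulr_natr; field.
rewrite expRD mulrCA -[leRHS]mulrA [leRHS]mulrCA ler_wpM2l ?(ltW p1)//.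
rewrite mulrCA [leRHS]mulrC ler_wpM2l ?expR_ge0//.
rewrite expRN ler_pdivrMr ?expR_gt0//.
apply: le_trans (normr_exp_le1D n x) _.
have x4 : 0 <= x ^+ 2 / 4 by rewrite divr_ge0// sqr_ge0.
rewrite mulrDl mul1r lerD//; first by rewrite (le_trans _ (expR_ge1Dx _))// lerDl.
rewrite -mulrA -ler_pdivrMl ?exprn_gt0// -ler_pdivrMl ?ltr0n ?fact_gt0//.
apply: le_trans (expR_ge1Dxn n x4).
rewrite ler_wpDl// expr_div_n -exprM mul2n [leRHS]mulrC ler_wpM2l ?invr_ge0// mulrC.
by [].
Qed.

Lemma integrable_moment_pdf (n : nat) :
  mu.-integrable [set: R] (fun x => (x ^+ n * phi x)%:E).
Proof.
have [C C0 Cle] := moment_pdf_le n.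
have ig : mu.-integrable [set: R] (fun x => (C * normal_pdf 0 (Num.sqrt 2) x)%:E).
  under eq_fun do rewrite EFinM.
  by apply: integrableZl => //; exact: integrable_normal_pdf.
apply: (le_integrable measurableT _ _ ig).
- apply/measurable_EFinP; apply: measurable_funM; first exact: measurable_funX.
  exact: measurable_normal_pdf.
- by move=> x _; rewrite lee_fin; apply: le_trans (Cle x) _; rewrite ler_norm.
Qed.

Lemma continuous_moment_pdf (n : nat) : continuous (fun x : R => x ^+ n * phi x).
Proof.
move=> x; apply: cvgM; first exact: exprn_continuous.
by apply: continuous_normal_pdf; exact: oner_neq0.
Qed.

(** The next power times the density is bounded, so this one decays like [1 / k]. The unit [s]
    treats both ends of the line at once. *)
Lemma cvg_moment_pdf (n : nat) (s : R) : `|s| = 1 ->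
  (s * k%:R) ^+ n * phi (s * k%:R) @[k --> \oo] --> 0.
Proof.
move=> s1.
have [C C0 Cle] := moment_pdf_le n.+1.
have s20 : Num.sqrt 2 != 0 :> R by rewrite gt_eqF// sqrtr_gt0.
apply/cvgrPdist_le => e e0; near=> k; rewrite sub0r normrN.
have k0 : (0 < k)%N by near: k; exact: nbhs_infty_gt.
have kR : 0 < k%:R :> R by rewrite ltr0n.
rewrite -(ler_pM2l kR).
have -> : k%:R * `|(s * k%:R) ^+ n * phi (s * k%:R)|
    = `|(s * k%:R) ^+ n.+1 * phi (s * k%:R)|.
  by rewrite exprS -mulrA [RHS]normrM [`|s * _|]normrM s1 mul1r normr_nat.
apply: le_trans (Cle _) _.
apply: le_trans (ler_wpM2l C0 (normal_pdf_ub _ _ s20)) _.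
rewrite -ler_pdivrMr//.
near: k; exact: nbhs_infty_ger.
Unshelve. all: by end_near. Qed.

Definition moment (n : nat) : R := (\int[mu]_x (x ^+ n * phi x))%R.

Lemma moment0 : moment 0 = 1.
Proof.
rewrite /moment /Rintegral; under eq_integral do rewrite expr0 mul1r.
by rewrite integral_normal_pdf.
Qed.

(* FTC on [-k, k] with k to infinity, where the boundary terms vanish. *)
Lemma Rintegral_derivative_eq0 (F f : R -> R) :
  (forall x : R, is_derive x 1 F (f x)) -> continuous f ->
  mu.-integrable [set: R] (EFin \o f) ->
  F k%:R @[k --> \oo] --> 0 -> F (- k%:R) @[k --> \oo] --> 0 ->
  (\int[mu]_x f x)%R = 0.
Proof.
move=> dF cf fi Fp Fm.
pose I k : set R := [set` `[- k%:R, k%:R]].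
have cF : continuous F.
  by move=> x; apply: differentiable_continuous; exact/derivable1_diffP.
have EI k : (0 < k)%N ->
    (\int[mu]_x ((EFin \o f) \_ (I k)) x = (F k%:R - F (- k%:R))%:E)%E.
  move=> k0; rewrite -integral_mkcond /=.
  rewrite (@continuous_FTC2 _ f F) ?EFinB//.
  - by rewrite ltrNl -subr_gt0 opprK addr_gt0// ltr0n.
  - exact: continuous_subspaceT.
  - split => [x _|//|//]; first exact: ex_derive.
    - exact/cvg_at_right_filter/cF.
    - exact/cvg_at_left_filter/cF.
  - by move=> x _; rewrite derive1E derive_val.
(* Dominated convergence: the truncations to [I k] are bounded by [|f|] and are eventually constant
   at each point. *)
have c1 : (\int[mu]_x ((EFin \o f) \_ (I k)) x @[k --> \oo] --> \int[mu]_x (EFin \o f) x)%E.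
  apply: (@dominated_cvg _ _ _ mu _ measurableT (fun k => (EFin \o f) \_ (I k))
    (EFin \o f) (abse \o (EFin \o f))) => //.
  - move=> k; apply/(measurable_restrictT _ _).1; first exact: measurable_itv.
    by apply: measurable_funTS; exact: measurable_int fi.
  - move=> x _; apply: cvg_near_cst; near=> k.
    rewrite patchE mem_set// /I/= in_itv/= -ler_norml.
    by near: k; exact: nbhs_infty_ger.
  - exact: integrable_abse.
  - move=> k x _; rewrite patchE; case: ifPn => // _.
    (* Outside [I k] the restriction takes the default value [point], which is 0 in the extended
       reals. *)
    by have -> : (point : \bar R) = 0%E by []; rewrite abse0 lee_fin normr_ge0.
have c2 : ((F k%:R - F (- k%:R))%:E @[k --> \oo] --> (0 - 0 : R)%:E)%E.
  by apply: cvg_EFin; [exact: nearW|exact: cvgB].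
have {}c2 : (\int[mu]_x ((EFin \o f) \_ (I k)) x @[k --> \oo] --> (0 - 0 : R)%:E)%E.
  apply: cvg_trans c2; apply: near_eq_cvg; near=> k; rewrite /= EI//.
  by near: k; exact: nbhs_infty_gt.
rewrite /Rintegral.
have := cvg_unique _ c1 c2.
by rewrite /comp /= => ->//; rewrite subr0.
Unshelve. all: by end_near. Qed.

Lemma moment1 : moment 1 = 0.
Proof.
rewrite -[moment 1]opprK -[RHS]oppr0; congr (- _).
have ix := integrable_moment_pdf 1.
rewrite /moment -mulN1r -RintegralZl//.
apply: (@Rintegral_derivative_eq0 phi).
- move=> x; apply: is_derive_eq (is_derive_std_normal_pdf x) _.
  by rewrite expr1 mulN1r.
- by move=> x; apply: cvgM; [exact: cvg_cst|exact: continuous_moment_pdf].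
- under [X in _.-integrable _ X]eq_fun do rewrite /= EFinM.
  exact: integrableZl.
- have := @cvg_moment_pdf 0 1 (normr1 _).
  by under eq_fun do rewrite mul1r expr0 mul1r.
- have := @cvg_moment_pdf 0 (-1) (normrN1 _).
  by under eq_fun do rewrite mulN1r expr0 mul1r.
Qed.

(** Integration by parts: [x ^+ n.+1 * phi x] vanishes at both ends, and its derivative is the
    difference of the two integrands. *)
Lemma momentSS (n : nat) : moment n.+2 = n.+1%:R * moment n.
Proof.
have i1 := integrable_moment_pdf n.
have i2 := integrable_moment_pdf n.+2.
apply/eqP; rewrite -subr_eq0 -opprB oppr_eq0; apply/eqP.
have i3 : mu.-integrable [set: R] (fun x => (n.+1%:R * (x ^+ n * phi x))%:E).
  by under eq_fun do rewrite EFinM; exact: integrableZl.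
rewrite /moment -RintegralZl// -RintegralB//.
apply: (@Rintegral_derivative_eq0 (fun x => x ^+ n.+1 * phi x)).
- move=> x.
  have dX : is_derive x 1 (fun y : R => y ^+ n.+1) (n.+1%:R * x ^+ n).
    have := @is_deriveX R R^o id n.+1 x 1 1 (is_derive_id x 1).
    by rewrite exprfctE /GRing.scale /= mulr1.
  apply: is_derive_eq (is_deriveM dX (is_derive_std_normal_pdf x)) _.
  by rewrite /GRing.scale /= !exprS; ring.
- move=> x; apply: cvgB; last exact: continuous_moment_pdf.
  by apply: cvgM; [exact: cvg_cst|exact: continuous_moment_pdf].
- under [X in _.-integrable _ X]eq_fun do rewrite /= EFinB.
  exact: integrableB.
- have := @cvg_moment_pdf n.+1 1 (normr1 _).
  by under eq_fun do rewrite mul1r.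
- have := @cvg_moment_pdf n.+1 (-1) (normrN1 _).
  by under eq_fun do rewrite mulN1r.
Qed.

Lemma moment_even : (moment 2 = 1) * (moment 4 = 3) * (moment 6 = 15).
Proof. by rewrite !momentSS moment0 !mulr1 -!natrM. Qed.

Lemma moment_odd : (moment 3 = 0) * (moment 5 = 0).
Proof. by rewrite !momentSS moment1 !mulr0. Qed.

End gaussian_moments.

(** * Random variables with all moments *)

Section moments.
Context d (T : measurableType d) (R : realType) (P : probability T R).

(** Asking for all powers at once makes the class stable under products, so every polynomial in
    Gaussian coordinates is integrable. *)
Definition has_moments (X : T -> R) : Prop :=
  measurable_fun [set: T] X /\
  forall n, P.-integrable [set: T] (fun w => (X w ^+ n)%:E).

Lemma has_moments_integrable X : has_moments X -> P.-integrable [set: T] (EFin \o X).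
Proof. by move=> [_ /(_ 1%N)]; apply: eq_integrable => // w _; rewrite expr1. Qed.

Lemma integrable_cst (c : R) : P.-integrable [set: T] (fun=> c%:E).
Proof. exact: finite_measure_integrable_cst. Qed.

Lemma has_moments_cst (c : R) : has_moments (fun=> c).
Proof. by split=> [|n]; [exact: measurable_cst|exact: integrable_cst]. Qed.

Lemma le_has_moments (X : T -> R) :
  measurable_fun [set: T] X ->
  (forall n, exists2 Y : T -> R, P.-integrable [set: T] (EFin \o Y) &
     forall w, `|X w| ^+ n <= Y w) -> has_moments X.
Proof.
move=> mX bX; split=> // n; have [Y iY XY] := bX n.
apply: (le_integrable measurableT _ _ iY) => [|w _].
  by apply/measurable_EFinP; exact: measurable_funX.
by rewrite lee_fin normrX (le_trans (XY w))// ler_norm.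
Qed.

Lemma has_momentsD (X Y : T -> R) :
  has_moments X -> has_moments Y -> has_moments (fun w => X w + Y w).
Proof.
move=> [mX iX] [mY iY]; apply: le_has_moments => [|n]; first exact: measurable_funD.
exists (fun w => 2 ^+ n * (`|X w| ^+ n + `|Y w| ^+ n)).
  have : P.-integrable [set: T] (fun w => (2 ^+ n)%:E * (`|X w ^+ n|%:E + `|Y w ^+ n|%:E))%E.
    apply: integrableZl => //; apply: integrableD => //.
      exact: (integrable_abse (iX n)).
    exact: (integrable_abse (iY n)).
  by apply: eq_integrable => // w _; rewrite -EFinD -EFinM !normrX.
move=> w.
have XY : `|X w + Y w| <= 2 * Num.max `|X w| `|Y w|.
  apply: le_trans (ler_normD _ _) _.
  by rewrite mulr_natl mulr2n lerD// le_max lexx ?orbT.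
apply: (@le_trans _ _ ((2 * Num.max `|X w| `|Y w|) ^+ n)).
  by rewrite lerXn2r// nnegrE ?mulr_ge0// le_max normr_ge0.
rewrite exprMn ler_wpM2l ?exprn_ge0//.
by case: (leP `|X w| `|Y w|) => _; rewrite ?lerDl ?lerDr exprn_ge0.
Qed.

Lemma has_momentsM (X Y : T -> R) :
  has_moments X -> has_moments Y -> has_moments (fun w => X w * Y w).
Proof.
move=> [mX iX] [mY iY]; apply: le_has_moments => [|n]; first exact: measurable_funM.
(* Young's inequality [a * b <= a ^+ 2 + b ^+ 2] with [a = |X| ^+ n] and [b = |Y| ^+ n]. *)
exists (fun w => X w ^+ n.*2 + Y w ^+ n.*2).
  have := integrableD measurableT (iX n.*2) (iY n.*2).
  by apply: eq_integrable => // w _; rewrite -EFinD.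
move=> w.
have sq (x : R) : x ^+ n.*2 = (`|x| ^+ n) ^+ 2.
  by rewrite -exprM muln2 -normrX ger0_norm// exprn_even_ge0// odd_double.
rewrite !sq normrM exprMn; set a := _ ^+ n; set b := _ ^+ n; nra.
Qed.

Lemma has_momentsX (X : T -> R) n : has_moments X -> has_moments (fun w => X w ^+ n).
Proof.
move=> hX; elim: n => [|n IHn].
  by under eq_fun do rewrite expr0; exact: has_moments_cst.
by under eq_fun do rewrite exprS; exact: has_momentsM.
Qed.

Lemma has_moments_sum (I : Type) (s : seq I) (p : pred I) (X : I -> T -> R) :
  (forall i, has_moments (X i)) -> has_moments (fun w => \sum_(i <- s | p i) X i w).
Proof.
move=> hX; elim: s => [|i s IHs].
  by under eq_fun do rewrite big_nil; exact: has_moments_cst.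
under eq_fun do rewrite big_cons.
by case: (p i) => //; exact: has_momentsD.
Qed.

Lemma integrable_sum_EFin (I : Type) (s : seq I) (p : pred I) (X : I -> T -> R) :
  (forall i, P.-integrable [set: T] (EFin \o X i)) ->
  P.-integrable [set: T] (EFin \o (fun w => \sum_(i <- s | p i) X i w)).
Proof.
move=> iX.
have : P.-integrable [set: T] (fun w => \sum_(j <- s | p j) (X j w)%:E)%E.
  by apply: integrable_sum => // j _; exact: iX.
by apply: eq_integrable => // w _; rewrite sumEFin.
Qed.

Lemma integrableZl_EFin (c : R) (X : T -> R) : P.-integrable [set: T] (EFin \o X) ->
  P.-integrable [set: T] (EFin \o (fun w => c * X w)).
Proof. by move=> /(integrableZl measurableT c); apply: eq_integrable. Qed.

Lemma integrableD_EFin (X Y : T -> R) : P.-integrable [set: T] (EFin \o X) ->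
  P.-integrable [set: T] (EFin \o Y) -> P.-integrable [set: T] (EFin \o (fun w => X w + Y w)).
Proof. by move=> iX /(integrableD measurableT iX); apply: eq_integrable. Qed.

Lemma Rintegral_sum (I : Type) (s : seq I) (p : pred I) (X : I -> T -> R) :
  (forall i, P.-integrable [set: T] (EFin \o X i)) ->
  \int[P]_w (\sum_(i <- s | p i) X i w) = \sum_(i <- s | p i) \int[P]_w X i w.
Proof.
move=> iX; elim: s => [|i s IHs].
  under eq_Rintegral do rewrite big_nil.
  by rewrite big_nil Rintegral_cst// mul0r.
under eq_Rintegral do rewrite big_cons.
rewrite big_cons; case: (p i) => //.
by rewrite RintegralD// ?IHs//; exact: integrable_sum_EFin.
Qed.

Lemma Rintegral_cstT (c : R) : \int[P]_w c = c.
Proof. by rewrite /Rintegral integral_cst//= probability_setT mule1. Qed.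

End moments.

(** * Integration against the law of a random variable *)

Section law.
Context d d' (T : measurableType d) (S : measurableType d') (R : realType).
Variables (P : probability T R) (Z : T -> S) (m : {measure set S -> \bar R}).
Hypothesis mZ : measurable_fun [set: T] Z.
Hypothesis lawZ : forall U, measurable U -> P (Z @^-1` U) = m U.

Let Z' : {mfun T >-> S} := HB.pack_for {mfun T >-> S} Z (isMeasurableFun.Build _ _ _ _ Z mZ).

Let integral_m (f : S -> \bar R) : (\int[m]_x f x = \int[distribution P Z']_x f x)%E.
Proof.
by apply: (@eq_measure_integral _ _ _ setT (distribution P Z') m f) => B mB _; exact/esym/lawZ.
Qed.

Lemma ge0_integral_law (f : S -> \bar R) : measurable_fun [set: S] f ->
  (forall x, 0 <= f x)%E -> (\int[m]_x f x = \int[P]_w f (Z w))%E.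
Proof. by move=> mf f0; rewrite integral_m ge0_integral_pushforward. Qed.

Lemma integrable_law (f : S -> \bar R) :
  m.-integrable [set: S] f -> P.-integrable [set: T] (f \o Z).
Proof.
case/integrableP => mf ioo; apply/integrableP; split.
  exact: measurableT_comp.
by rewrite -(ge0_integral_law (f := fun x => `|f x|%E))//; exact: measurableT_comp.
Qed.

Lemma integral_law (f : S -> \bar R) :
  m.-integrable [set: S] f -> (\int[m]_x f x = \int[P]_w f (Z w))%E.
Proof.
move=> im; rewrite integral_m integral_pushforward//; first exact: measurable_int im.
exact: integrable_law.
Qed.

End law.

Section gaussian_law.
Variable R : realType.
Local Notation mu := lebesgue_measure.
Local Notation nu := (normal_prob (0 : R) 1).
Local Notation phi := (normal_pdf (0 : R) 1).

Lemma ge0_integral_std_normal (f : R -> \bar R) :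
  (forall x, 0 <= f x)%E -> measurable_fun [set: R] f ->
  (\int[nu]_x f x = \int[mu]_x (f x * (phi x)%:E))%E.
Proof.
move=> f0 mf.
have dom : nu `<< mu := @normal_prob_dominates R 0 1.
have mphi : measurable_fun [set: R] (EFin \o phi).
  by apply/measurable_EFinP; exact: measurable_normal_pdf.
have iRN := Radon_Nikodym_SigmaFinite.f_integrable dom.
rewrite -(Radon_Nikodym_SigmaFinite.change_of_variables dom)//.
apply: ae_eq_integral => //.
- by apply: emeasurable_funM => //; exact: measurable_int iRN.
- exact: emeasurable_funM.
(* The Radon-Nikodym derivative and the explicit density have the same integral over every
   measurable set, so they agree almost everywhere. *)
- apply: ae_eqe_mul2l; apply: integral_ae_eq => // E _ mE.
  by rewrite -(Radon_Nikodym_SigmaFinite.f_integral dom).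
Qed.

Lemma std_normal_moments n :
  nu.-integrable [set: R] (fun x => (x ^+ n)%:E) /\ \int[nu]_x (x ^+ n) = moment R n.
Proof.
have mX : measurable_fun [set: R] (fun x : R => (x ^+ n)%:E).
  by apply/measurable_EFinP; exact: measurable_funX.
have phi0 (x : R) : (0 <= (phi x)%:E)%E by rewrite lee_fin normal_pdf_ge0.
have iM := integrable_moment_pdf R n.
split.
  apply/integrableP; split => //.
  rewrite ge0_integral_std_normal//; last exact: measurableT_comp.
  case/integrableP : iM => _; apply: le_lt_trans.
  by under [leRHS]eq_integral do rewrite EFinM abseM (gee0_abs (phi0 _)).
rewrite /moment /Rintegral; congr fine.
(* The change of density holds for nonnegative functions, so it is applied to the positive and
   negative parts; the nonnegative factor [phi] commutes with both. *)
rewrite [LHS]integralE [RHS]integralE.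
rewrite !ge0_integral_std_normal//; last 2 first.
- exact: measurable_funeneg.
- exact: measurable_funepos.
congr (_ - _)%E; apply: eq_integral => x _.
  by rewrite !funeposE EFinM ![(_ * (phi x)%:E)%E]muleC maxe_pMr// mule0.
by rewrite !funenegE EFinM ![(_ * (phi x)%:E)%E]muleC -muleN maxe_pMr// mule0.
Qed.

Lemma std_normal_law_moments d (T : measurableType d) (P : probability T R)
    (X : T -> R) :
  measurable_fun [set: T] X ->
  (forall B, measurable B -> P (X @^-1` B) = nu B) ->
  has_moments P X /\ forall n, \int[P]_w (X w ^+ n) = moment R n.
Proof.
move=> mX PX.
split=> [|n].
  split=> // n; have [iX _] := std_normal_moments n.
  exact: (@integrable_law _ _ T (measurableTypeR R) R P X nu mX PX _ iX).
have [iX <-] := std_normal_moments n.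
by rewrite /Rintegral (@integral_law _ _ T (measurableTypeR R) R P X nu mX PX _ iX).
Qed.

End gaussian_law.

(** * Independence *)

Section independence.
Context d (T : measurableType d) (R : realType) (P : probability T R).

(** Independence makes the joint law of the pair the product of the two laws, and Fubini factors the
    integral. *)
Lemma indep_Rintegral_mul (X Y : T -> R) :
  P.-integrable [set: T] (EFin \o X) -> P.-integrable [set: T] (EFin \o Y) ->
  (forall A B, measurable A -> measurable B ->
     P (X @^-1` A `&` Y @^-1` B) = (P (X @^-1` A) * P (Y @^-1` B))%E) ->
  P.-integrable [set: T] (fun w => (X w * Y w)%:E) /\
  \int[P]_w (X w * Y w) = (\int[P]_w X w) * (\int[P]_w Y w).
Proof.
move=> iX iY XY.
have mX : measurable_fun [set: T] X by apply/measurable_EFinP; exact: measurable_int iX.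
have mY : measurable_fun [set: T] Y by apply/measurable_EFinP; exact: measurable_int iY.
pose X' : {mfun T >-> R} := HB.pack_for {mfun T >-> R} X (isMeasurableFun.Build _ _ _ _ X mX).
pose Y' : {mfun T >-> R} := HB.pack_for {mfun T >-> R} Y (isMeasurableFun.Build _ _ _ _ Y mY).
pose Z w := (X w, Y w).
have mZ : measurable_fun [set: T] Z by exact: measurable_fun_pair.
pose Z' : {mfun T >-> (R * R)%type} :=
  HB.pack_for {mfun T >-> (R * R)%type} Z (isMeasurableFun.Build _ _ _ _ Z mZ).
pose m1 : probability R R := distribution P X'.
pose m2 : probability R R := distribution P Y'.
(* A product measure is determined by its values on rectangles, where the hypothesis gives the
   factorization. *)
have lawZ U : measurable U -> P (Z @^-1` U) = (m1 \x m2)%E U.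
  move=> mU; apply/esym; apply: (@product_measure_unique _ _ _ _ _ m1 m2 (distribution P Z')) => //.
have mid : measurable_fun [set: R] (fun x : R => x%:E) by apply/measurable_EFinP.
have mnid : measurable_fun [set: R] (fun x : R => `|x%:E|%E) by exact: measurableT_comp.
have lawX U : measurable U -> P (X @^-1` U) = m1 U by [].
have lawY U : measurable U -> P (Y @^-1` U) = m2 U by [].
have nX : (\int[m1]_x `|x%:E| < +oo)%E.
  rewrite (ge0_integral_law mX lawX)//.
  by case/integrableP : iX.
have nY : (\int[m2]_x `|x%:E| < +oo)%E.
  rewrite (ge0_integral_law mY lawY)//.
  by case/integrableP : iY.
have i1 : m1.-integrable [set: R] (fun x => x%:E) by apply/integrableP.
have i2 : m2.-integrable [set: R] (fun x => x%:E) by apply/integrableP.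
have mM : measurable_fun [set: R * R] (fun z : R * R => (z.1 * z.2)%:E).
  apply/measurable_EFinP; apply: measurable_funM.
    exact: measurable_fst.
  exact: measurable_snd.
have im : (m1 \x m2)%E.-integrable [set: R * R] (fun z : R * R => (z.1 * z.2)%:E).
  apply: (@integrable12ltyP _ _ _ _ R m1 m2 _ mM).2.
  have E x : (\int[m2]_y `|(x * y)%:E| = `|x%:E| * \int[m2]_y `|y%:E|)%E.
    by under eq_integral do rewrite EFinM abseM; rewrite ge0_integralZl.
  rewrite [ltLHS](_ : _ = \int[m1]_x (`|x%:E| * \int[m2]_y `|y%:E|))%E; last first.
    by apply: eq_integral => x _; exact: E.
  rewrite ge0_integralZr//; last exact: integral_ge0.
  by rewrite lte_mul_pinfty// ?integral_ge0// ge0_fin_numE// integral_ge0.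
split; first exact: (integrable_law mZ lawZ im).
have fX := integrable_fin_num measurableT i1.
have fY := integrable_fin_num measurableT i2.
rewrite /Rintegral -(integral_law mZ lawZ im).
rewrite -(integral_law mX lawX i1) -(integral_law mY lawY i2) -fineM//.
congr fine; rewrite -integral12_prod_meas1// /fubini_F.
have E x : (\int[m2]_y (x * y)%:E = x%:E * \int[m2]_y y%:E)%E.
  by under eq_integral do rewrite EFinM; rewrite integralZl.
rewrite [LHS](_ : _ = \int[m1]_x (x%:E * \int[m2]_y y%:E))%E; last first.
  by apply: eq_integral => x _; exact: E.
by rewrite -(fineK fY) integralZr.
Qed.

(** The finite measures [P (A & B)] and [P A * P B], as functions of [A], agree on the pi-system
    [G], hence on the sigma-algebra it generates. *)
Lemma indep_generated (G : set (set T)) (B : set T) :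
  G `<=` measurable -> G setT -> setI_closed G -> measurable B ->
  (forall A, G A -> P (A `&` B) = (P A * P B)%E) ->
  forall A, <<s G >> A -> P (A `&` B) = (P A * P B)%E.
Proof.
move=> Gm GT GI mB GB A sA.
have PB : (0 <= fine (P B)) by rewrite fine_ge0.
pose k : {nonneg R} := NngNum PB.
have /(_ A sA) : forall E, <<s G >> E -> mrestr P mB E = mscale k P E.
  apply: (g_sigma_algebra_measure_unique G Gm (fun=> setT) (fun=> GT) _
    (mrestr P mB) (mscale k P)) => //.
  - by rewrite bigcup_const//; exists 0%N.
  - move=> C GC; change (P (C `&` B) = ((fine (P B))%:E * P C)%E).
    by rewrite GB// fineK ?fin_num_measure// muleC.
  - by move=> _; change (P (setT `&` B) < +oo)%E; rewrite setTI ltey_eq fin_num_measure.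
change (P (A `&` B) = ((fine (P B))%:E * P A)%E -> P (A `&` B) = (P A * P B)%E).
by move=> ->; rewrite fineK ?fin_num_measure// muleC.
Qed.

Lemma measurable_fun_generated (G G' : set (set T)) (X : T -> R) :
  G `<=` <<s G' >> ->
  measurable_fun [set: g_sigma_algebraType G] X ->
  measurable_fun [set: g_sigma_algebraType G'] X.
Proof.
move=> GG' mX _ B mB; have := mX measurableT B mB.
by apply: smallest_sub => //; exact: smallest_sigma_algebra.
Qed.

Lemma measurable_fun_generatedT (G : set (set T)) (X : T -> R) :
  G `<=` measurable ->
  measurable_fun [set: g_sigma_algebraType G] X -> measurable_fun [set: T] X.
Proof.
move=> Gm mX _ B mB; have := mX measurableT B mB.
by apply: smallest_sub => //; exact: sigma_algebra_measurable.
Qed.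

Lemma independent_Rintegral_mul (G H : set (set T)) (X Y : T -> R) :
  independent_systems P <<s G >> <<s H >> ->
  measurable_fun [set: g_sigma_algebraType G] X ->
  measurable_fun [set: g_sigma_algebraType H] Y ->
  P.-integrable [set: T] (EFin \o X) -> P.-integrable [set: T] (EFin \o Y) ->
  P.-integrable [set: T] (fun w => (X w * Y w)%:E) /\
  \int[P]_w (X w * Y w) = (\int[P]_w X w) * (\int[P]_w Y w).
Proof.
move=> GH mX mY iX iY; apply: indep_Rintegral_mul => // A B mA mB; apply: GH.
  by have := mX measurableT A mA; rewrite setTI.
by have := mY measurableT B mB; rewrite setTI.
Qed.

End independence.

(** * Gaussian vectors *)

Section dot_product.
Context (R : realType) (n : nat).
Implicit Types (u v w : 'rV[R]_n) (M : 'M[R]_n).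

Definition dot u v : R := \sum_(i < n) u 0 i * v 0 i.

Lemma dotE u v : (u *m v^T) 0 0 = dot u v.
Proof. by rewrite mxE; apply: eq_bigr => i _; rewrite mxE. Qed.

Lemma dotC u v : dot u v = dot v u.
Proof. by apply: eq_bigr => i _; rewrite mulrC. Qed.

Lemma dotDl u v w : dot (u + v) w = dot u w + dot v w.
Proof. by rewrite -!dotE mulmxDl mxE. Qed.

Lemma dotDr u v w : dot u (v + w) = dot u v + dot u w.
Proof. by rewrite dotC dotDl !(dotC u). Qed.

Lemma dotZl (c : R) u v : dot (c *: u) v = c * dot u v.
Proof. by rewrite -!dotE -scalemxAl mxE. Qed.

Lemma dotZr (c : R) u v : dot u (c *: v) = c * dot u v.
Proof. by rewrite dotC dotZl dotC. Qed.

Lemma dot_ge0 u : 0 <= dot u u.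
Proof. by apply: sumr_ge0 => i _; rewrite -expr2 sqr_ge0. Qed.

Lemma dot_eq0 u : dot u u = 0 -> u = 0.
Proof.
move=> /eqP; rewrite psumr_eq0 => [/allP u0|i _]; last by rewrite -expr2 sqr_ge0.
apply/rowP => i; rewrite mxE; apply/eqP.
by have := u0 i (mem_index_enum i); rewrite -expr2 sqrf_eq0.
Qed.

Lemma dot0l v : dot 0 v = 0.
Proof. by rewrite -(scale0r (0 : 'rV[R]_n)) dotZl mul0r. Qed.

Lemma dot_mulmx u M v : dot (u *m M) v = dot u (v *m M^T).
Proof. by rewrite -!dotE trmx_mul trmxK mulmxA. Qed.

Lemma dot_delta u i : dot u (delta_mx 0 i) = u 0 i.
Proof.
rewrite /dot (bigD1 i)//= big1 ?addr0 => [|j ji]; first by rewrite mxE !eqxx mulr1.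
by rewrite mxE (negPf ji) andbF mulr0.
Qed.

End dot_product.

(** This is the induction step for [gaussian_dot_moments]: [s] lists the moments of a partial sum of
    variance [v], to which an independent term [b * X] with [X] standard normal is added. The odd
    moments of [X] vanish, so only even moments of the partial sum enter the binomial expansion. *)
Lemma gaussian_binomial_moments (R : realType) (s : nat -> R) (b v : R) :
  s 0 = 1 -> s 2 = v -> s 4 = 3 * v ^+ 2 -> s 6 = 15 * v ^+ 3 ->
  let e k := \sum_(i < k.+1) (b ^+ i * (s (k - i)%N * moment R i)) *+ 'C(k, i) in
  [/\ e 2 = v + b ^+ 2, e 4 = 3 * (v + b ^+ 2) ^+ 2 & e 6 = 15 * (v + b ^+ 2) ^+ 3].
Proof.
move=> s0 s2 s4 s6.
have [[m2 m4] m6] := moment_even R; have [m3 m5] := moment_odd R.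
move: (moment0 R) (moment1 R) m2 m4 m6 m3 m5.
move: (moment R) => mo mo0 mo1 mo2 mo4 mo6 mo3 mo5 e.
have Ee k : e k = \sum_(0 <= i < k.+1) (b ^+ i * (s (k - i)%N * mo i)) *+ 'C(k, i).
  by rewrite big_mkord.
split; rewrite Ee !big_nat_recr //= big_geq //.
- rewrite subnn s0 subn0 s2 mo0 mo1 mo2 binn bin0; ring.
- rewrite subnn s0 subn0 s4 [(4 - 2)%N]/= s2 mo0 mo1 mo2 mo3 mo4.
  by rewrite !mulr0 !mul0rn binn bin0 (_ : 'C(4, 2) = 6)//; ring.
- rewrite subnn s0 subn0 s6 [(6 - 2)%N]/= s4 [(6 - 4)%N]/= s2 mo0 mo1 mo2 mo3 mo4 mo5 mo6.
  by rewrite !mulr0 !mul0rn binn bin0 (_ : 'C(6, 2) = 15)// (_ : 'C(6, 4) = 15)//; ring.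
Qed.

Section gaussian_vector.
Context disp (T : measurableType disp) (R : realType) (P : probability T R).
Context (n : nat) (xi : T -> 'rV[R]_n).
Hypothesis gxi : standard_gaussian P xi.

Let mxi i : measurable_fun [set: T] (fun w => xi w 0 i).
Proof. by have [m _] := gxi. Qed.

Lemma gaussian_coord_law i (B : set R) : measurable B ->
  P ((fun w => xi w 0 i) @^-1` B) = normal_prob 0 1 B.
Proof.
move=> mB; have [_ /(_ (fun j => if j == i then B else setT))] := gxi.
rewrite (bigD1 i)//= eqxx big1 ?mule1 => [|j ji]; last first.
  by rewrite (negPf ji) probability_setT.
move=> <-; last by move=> j; case: ifP.
congr (P _); apply/seteqP; split => w /= => [Bw j|/(_ i)]; last by rewrite eqxx.
by case: eqP => [->|].
Qed.

Lemma gaussian_coord_moments i : has_moments P (fun w => xi w 0 i) /\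
  forall k, \int[P]_w (xi w 0 i ^+ k) = moment R k.
Proof. by apply: std_normal_law_moments => // B mB; exact: gaussian_coord_law. Qed.

(* A pi-system generating the sigma-algebra of the first m coordinates. *)
Definition initial_rectangles (m : nat) : set (set T) :=
  [set A | exists B : 'I_n -> set R, [/\ forall i, measurable (B i),
    forall i : 'I_n, (m <= i)%N -> B i = setT &
    A = [set w | forall i, B i (xi w 0 i)]]].

Lemma initial_rectangles_measurable m : initial_rectangles m `<=` measurable.
Proof.
move=> _ [B [mB _ ->]].
rewrite (_ : [set _ | _] = \bigcap_(i in [set: 'I_n]) ((fun w => xi w 0 i) @^-1` B i)).
  by apply: fin_bigcap_measurable => // i _; rewrite -[X in measurable X]setTI; exact: mxi.
by apply/seteqP; split => w /= h i; [move=> _|]; exact: h.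
Qed.

Lemma initial_rectanglesT m : initial_rectangles m setT.
Proof. by exists (fun=> setT); split => //; apply/seteqP; split. Qed.

Lemma initial_rectanglesI m : setI_closed (initial_rectangles m).
Proof.
move=> _ _ [B [mB B1 ->]] [C [mC C1 ->]].
exists (fun i => B i `&` C i); split => [i|i mi|]; first exact: measurableI.
  by rewrite B1// C1// setTI.
by apply/seteqP; split => w /= => [[h1 h2] i|h]; [split|split=> i; have [] := h i].
Qed.

Lemma initial_rectangles_indep (j : 'I_n) (C : set R) : measurable C ->
  forall A, initial_rectangles j A ->
  P (A `&` (fun w => xi w 0 j) @^-1` C) = (P A * P ((fun w => xi w ord0 j) @^-1` C))%E.
Proof.
move=> mC _ [B [mB B1 ->]]; rewrite gaussian_coord_law//.
have [_ gP] := gxi.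
rewrite (gP B)// (bigD1 j)//= B1// probability_setT mul1e.
(* The [j]-th side of the rectangle is the whole line, so intersecting with the event on coordinate
   [j] just replaces that side by [C]. *)
pose B' i := if i == j then C else B i.
transitivity (P [set w | forall i, B' i (xi w 0 i)]).
  congr (P _); apply/seteqP; split => w /= => [[h1 h2] i|h].
    by rewrite /B'; case: eqP => [->|].
  split=> [i|]; last by have := h j; rewrite /B' eqxx.
  have := h i; rewrite /B'; case: eqP => // -> _.
  by rewrite B1.
rewrite gP; last by move=> i; rewrite /B'; case: ifP.
rewrite (bigD1 j)//= {1}/B' eqxx muleC; congr (_ * _)%E.
by apply: eq_bigr => i ij; rewrite /B' (negPf ij).
Qed.

Lemma measurable_partial_dot (a : 'rV[R]_n) (m : nat) :
  measurable_fun [set: g_sigma_algebraType (initial_rectangles m)]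
    (fun w => \sum_(i < n | (i < m)%N) a 0 i * xi w 0 i).
Proof.
under eq_fun do rewrite big_mkcond.
apply: (@measurable_sum _ (g_sigma_algebraType (initial_rectangles m)) R setT 'I_n _
  (fun i w => if (i < m)%N then a 0 i * xi w 0 i else 0)) => i;
  case im : (i < m)%N; last exact: measurable_cst.
apply: measurable_funM; first exact: measurable_cst.
move=> _ U mU; rewrite setTI; apply: sub_sigma_algebra.
exists (fun k => if k == i then U else setT); split.
- by move=> k; case: ifP.
- by move=> k mk; case: eqP => // ki; move: mk; rewrite ki leqNgt im.
- apply/seteqP; split => w /= => [h k|/(_ i)]; last by rewrite eqxx.
  by case: eqP => [->|].
Qed.

Lemma indep_sum_moments (S X : T -> R) (b : R) (k : nat) :
  has_moments P S -> has_moments P X ->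
  (forall A B, measurable A -> measurable B ->
     P (S @^-1` A `&` X @^-1` B) = (P (S @^-1` A) * P (X @^-1` B))%E) ->
  \int[P]_w ((S w + b * X w) ^+ k) =
  \sum_(i < k.+1) (b ^+ i * ((\int[P]_w (S w ^+ (k - i))) * (\int[P]_w (X w ^+ i)))) *+ 'C(k, i).
Proof.
move=> hS hX SX.
have ind i j : P.-integrable [set: T] (fun w => (S w ^+ i * X w ^+ j)%:E) /\
    \int[P]_w (S w ^+ i * X w ^+ j) = (\int[P]_w (S w ^+ i)) * (\int[P]_w (X w ^+ j)).
  apply: indep_Rintegral_mul; [exact: hS.2|exact: hX.2|move=> A B mA mB].
  have mp l (U : set R) : measurable U -> measurable ((fun x : R => x ^+ l) @^-1` U).
    move=> mU; rewrite -[X in measurable X]setTI.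
    exact: (measurable_funX l (@measurable_id _ R setT)).
  exact: (SX _ _ (mp i A mA) (mp j B mB)).
under eq_Rintegral do rewrite exprDn.
rewrite Rintegral_sum => [|i]; last first.
  have [iSX _] := ind (k - i)%N i.
  have := integrableZl measurableT (b ^+ i *+ 'C(k, i)) iSX.
  apply: eq_integrable => // w _; rewrite /= -EFinM; congr EFin.
  by rewrite exprMn mulrnAl mulrCA.
apply: eq_bigr => i _; have [iSX <-] := ind (k - i)%N i.
rewrite -mulrnAl -RintegralZl//; apply: eq_Rintegral => w _.
by rewrite exprMn mulrnAl mulrCA.
Qed.

(** Coordinates are added one at a time: the partial sum over the indices below [m] is independent
    of coordinate [m], and the three even moments propagate together. *)
Lemma gaussian_dot_moments (a : 'rV[R]_n) :
  [/\ has_moments P (fun w => dot a (xi w)),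
      \int[P]_w (dot a (xi w) ^+ 2) = dot a a,
      \int[P]_w (dot a (xi w) ^+ 4) = 3 * dot a a ^+ 2 &
      \int[P]_w (dot a (xi w) ^+ 6) = 15 * dot a a ^+ 3].
Proof.
pose S m w := \sum_(i < n | (i < m)%N) a 0 i * xi w 0 i.
pose v m := \sum_(i < n | (i < m)%N) a 0 i * a 0 i.
have hS m : has_moments P (S m).
  apply: has_moments_sum => i; apply: has_momentsM; first exact: has_moments_cst.
  by have [] := gaussian_coord_moments i.
suff main m : (m <= n)%N -> [/\ \int[P]_w (S m w ^+ 2) = v m,
    \int[P]_w (S m w ^+ 4) = 3 * v m ^+ 2 & \int[P]_w (S m w ^+ 6) = 15 * v m ^+ 3].
  have ES w : dot a (xi w) = S n w by apply: eq_bigl => i; rewrite ltn_ord.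
  have Ev : dot a a = v n by apply: eq_bigl => i; rewrite ltn_ord.
  have [m2 m4 m6] := main n (leqnn n).
  rewrite Ev; split; last 3 first.
  - by under eq_Rintegral do rewrite ES.
  - by under eq_Rintegral do rewrite ES.
  - by under eq_Rintegral do rewrite ES.
  - by rewrite (_ : (fun w => dot a (xi w)) = S n)//; apply/funext.
elim: m => [|m IHm] mn.
  have S0 w : S 0 w = 0 by rewrite /S big_pred0.
  have v0 : v 0 = 0 by rewrite /v big_pred0.
  rewrite v0; split; under eq_Rintegral do rewrite S0 expr0n /=; rewrite Rintegral_cstT; ring.
have {IHm} [m2 m4 m6] := IHm (ltnW mn).
pose j := Ordinal mn; pose b := a 0 j.
have splitS (F : 'I_n -> R) : \sum_(i < n | (i < m.+1)%N) F i = (\sum_(i < n | (i < m)%N) F i) + F j.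
  rewrite (bigD1 j) ?leqnn//= addrC; congr (_ + _); apply: eq_bigl => i.
  by rewrite ltnS [RHS]ltn_neqAle andbC.
have ES w : S m.+1 w = S m w + b * xi w 0 j by rewrite /S splitS.
have Ev : v m.+1 = v m + b ^+ 2 by rewrite /v splitS.
have [hX EX] := gaussian_coord_moments j.
(* Independence is known on rectangles in the first [m] coordinates and extends to the sigma-algebra
   they generate, for which [S m] is measurable. *)
have ind A B : measurable A -> measurable B ->
    P (S m @^-1` A `&` (fun w => xi w 0 j) @^-1` B) =
    (P (S m @^-1` A) * P ((fun w => xi w ord0 j) @^-1` B))%E.
  move=> mA mB; apply: (@indep_generated _ _ _ _ (initial_rectangles m)).
  - exact: initial_rectangles_measurable.
  - exact: initial_rectanglesT.
  - exact: initial_rectanglesI.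
  - by rewrite -[X in measurable X]setTI; exact: mxi.
  - by move=> C; exact: (@initial_rectangles_indep j).
  - by have := @measurable_partial_dot a m measurableT A mA; rewrite setTI.
have s0 : \int[P]_w (S m w ^+ 0) = 1.
  by under eq_Rintegral do rewrite expr0; rewrite Rintegral_cstT.
have [e2 e4 e6] := @gaussian_binomial_moments R (fun k => \int[P]_w (S m w ^+ k)) b (v m) s0 m2 m4 m6.
have expand k : \int[P]_w (S m.+1 w ^+ k) =
    \sum_(i < k.+1) (b ^+ i * ((\int[P]_w (S m w ^+ (k - i))) * moment R i)) *+ 'C(k, i).
  under eq_Rintegral do rewrite ES.
  rewrite (indep_sum_moments b k (hS m) hX ind).
  by apply: eq_bigr => i _; rewrite EX.
by rewrite Ev !expand.
Qed.

End gaussian_vector.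

(** * Positive semidefinite matrices and Gaussian quadratic forms *)

Section psd.
Context (R : realType) (n : nat).
Implicit Types (A M : 'M[R]_n) (u v a b : 'rV[R]_n).

Definition psd A : Prop := forall v, 0 <= dot (v *m A) v.

Lemma sym_dot A u v : A^T = A -> dot (u *m A) v = dot (v *m A) u.
Proof. by move=> As; rewrite dot_mulmx As dotC. Qed.

Lemma delta_dot A i j : dot (delta_mx 0 i *m A) (delta_mx 0 j) = A i j.
Proof. by rewrite dot_delta -rowE mxE. Qed.

Lemma dot_rank1 a v : dot (v *m (a^T *m a)) v = dot a v ^+ 2.
Proof. by rewrite -dotE mulmxA -mulmxA mxE big_ord1 !dotE [dot v a]dotC. Qed.

Lemma tr_rank1 a : \tr (a^T *m a) = dot a a.
Proof. by rewrite mxtrace_mulC /mxtrace big_ord1 dotE. Qed.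

Lemma psd_diag0 A i j : A^T = A -> psd A -> A i i = 0 -> A i j = 0.
Proof.
move=> As Apsd Aii; apply/eqP; apply/negPn/negP => Aij.
have Aji : A j i = A i j by rewrite -[in LHS]As mxE.
(* With [A i i = 0] the form at [c e_i + e_j] equals [2 * c * A i j + A j j]; this [c] makes it -1,
   against positivity. *)
pose c := - (A j j + 1) / (2 * A i j).
have := Apsd (c *: delta_mx 0 i + delta_mx 0 j).
rewrite mulmxDl !(dotDl, dotDr) -!scalemxAl !(dotZl, dotZr) !delta_dot Aii Aji.
rewrite (_ : _ + _ = -1) ?oppr_ge0 ?ler10//.
by rewrite /c; field.
Qed.

(* Completing the square: A - a^T a / A_ii, for a the i-th row of A, is still
   PSD and its i-th diagonal entry vanishes. *)
Lemma psd_sum_rank1 A : A^T = A -> psd A ->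
  exists s : seq 'rV[R]_n, A = \sum_(b <- s) b^T *m b.
Proof.
(* Induction on the number of nonzero diagonal entries. *)
have [m] := ubnP #|[pred i | A i i != 0]|.
elim: m A => // m IHm A; rewrite ltnS => cA As Apsd.
have [A0|[i Aii]] : (forall i, A i i = 0) \/ exists i, A i i != 0.
  case: (pickP (fun i => A i i != 0)) => [i Ai|A0]; [by right; exists i|left=> i].
  by apply/eqP; have := A0 i => /negbFE.
  exists [::]; rewrite big_nil; apply/matrixP => i j; rewrite mxE.
  exact: psd_diag0.
have Aii0 : 0 < A i i by rewrite lt_neqAle eq_sym Aii -(delta_dot A i i) Apsd.
pose a := (Num.sqrt (A i i))^-1 *: row i A.
have Eav v : dot a v = (Num.sqrt (A i i))^-1 * dot (delta_mx 0 i *m A) v.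
  by rewrite /a dotZl rowE.
have sq2 (x : R) : ((Num.sqrt (A i i))^-1 * x) ^+ 2 = (A i i)^-1 * x ^+ 2.
  by rewrite exprMn exprVn sqr_sqrtr// ltW.
pose A' := A - a^T *m a.
have diagA' j : A' j j = A j j - (A i i)^-1 * A i j ^+ 2.
  by rewrite /A' !mxE big_ord1 !mxE -expr2 sq2.
have A'ii : A' i i = 0 by rewrite diagA' expr2 mulrA mulVf// mul1r subrr.
have A'psd : psd A'.
  (* This [c] minimizes the form of [A] on the line through [v] in direction [e_i]; the minimum is
     the form of [A'] at [v]. *)
  move=> v; pose p := dot (delta_mx 0 i *m A) v; pose c := - ((A i i)^-1 * p).
  have := Apsd (v + c *: delta_mx 0 i).
  have -> : dot ((v + c *: delta_mx 0 i) *m A) (v + c *: delta_mx 0 i) =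
      dot (v *m A) v + 2 * c * p + c ^+ 2 * A i i.
    rewrite mulmxDl -scalemxAl !(dotDl, dotDr) !(dotZl, dotZr) delta_dot.
    by rewrite (sym_dot v (delta_mx 0 i) As) -/p; ring.
  have -> : dot (v *m A') v = dot (v *m A) v - (A i i)^-1 * p ^+ 2.
    by rewrite /A' mulmxBr dotDl -scaleN1r dotZl dot_rank1 Eav sq2 mulN1r.
  by rewrite /c; congr (_ <= _); field.
have A's : A'^T = A' by rewrite /A' linearB /= trmx_mul trmxK As.
have [|s Es] := IHm A' _ A's A'psd.
  (* A vanishing diagonal entry stays zero, because its whole row is zero; the entry [i] becomes
     zero, so the count drops. *)
  apply: leq_trans cA; apply: proper_card; apply/properP; split.
    apply/fintype.subsetP => j; rewrite !inE; apply: contra_neq => Aj.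
    have Aij : A i j = 0 by rewrite -[in LHS]As mxE; exact: psd_diag0.
    by rewrite diagA' Aj Aij expr2 !mulr0 subr0.
  by exists i; rewrite !inE ?A'ii ?eqxx.
by exists (a :: s); rewrite big_cons -Es /A' addrC subrK.
Qed.

(** The diagonal is nonnegative, so a trace that is not positive forces it to vanish, and then
    [psd_diag0] kills all other entries. *)
Lemma psd_tr_gt0 A : A^T = A -> psd A -> A != 0 -> 0 < \tr A.
Proof.
move=> As Apsd; apply: contra_neqT; rewrite -leNgt => tA.
have d0 i : 0 <= A i i by rewrite -(delta_dot A i i) Apsd.
have /eqP : \tr A = 0 by apply/eqP; rewrite eq_le tA sumr_ge0.
rewrite psumr_eq0 => [/allP A0|i _]; last exact: d0.
apply/matrixP => i j; rewrite mxE; apply: psd_diag0 => //.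
by apply/eqP; exact: A0 (mem_index_enum i).
Qed.

End psd.

Section gaussian_quadratic_form.
Context disp (T : measurableType disp) (R : realType) (P : probability T R).
Context (n : nat) (xi : T -> 'rV[R]_n) (A : 'M[R]_n).
Hypothesis gxi : standard_gaussian P xi.
Hypotheses (As : A^T = A) (Apsd : psd A).

Let hdot a : has_moments P (fun w => dot a (xi w)).
Proof. by have [] := gaussian_dot_moments gxi a. Qed.

Lemma has_moments_quadratic_form : has_moments P (fun w => dot (xi w *m A) (xi w)).
Proof.
have [s ->] := psd_sum_rank1 As Apsd.
have E w : dot (xi w *m (\sum_(b <- s) b^T *m b)) (xi w) = \sum_(b <- s) dot b (xi w) ^+ 2.
  elim: s => [|b s IHs]; first by rewrite !big_nil mulmx0 dot0l.
  by rewrite !big_cons mulmxDr dotDl dot_rank1 IHs.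
under eq_fun do rewrite E.
by apply: has_moments_sum => b; apply: has_momentsX.
Qed.

Let integrableM2 (X Y : T -> R) : has_moments P X -> has_moments P Y ->
  P.-integrable [set: T] (fun w => (X w * Y w)%:E).
Proof. by move=> hX hY; exact: has_moments_integrable (has_momentsM hX hY). Qed.

Lemma Rintegral_dot2_dot2_le a b :
  \int[P]_w (dot a (xi w) ^+ 2 * dot b (xi w) ^+ 2) <= 3 * dot a a * dot b b.
Proof.
have zero (c e : 'rV[R]_n) : dot c c = 0 ->
    \int[P]_w (dot c (xi w) ^+ 2 * dot e (xi w) ^+ 2) = 0.
  move=> /dot_eq0 ->; under eq_Rintegral do rewrite dot0l expr0n /= mul0r.
  by rewrite Rintegral_cstT.
have [a0|a0] := eqVneq (dot a a) 0; first by rewrite zero// a0 mulr0 mul0r.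
have [b0|b0] := eqVneq (dot b b) 0.
  by under eq_Rintegral do rewrite mulrC; rewrite zero// b0 mulr0.
have {}a0 : 0 < dot a a by rewrite lt_neqAle eq_sym a0 dot_ge0.
have {}b0 : 0 < dot b b by rewrite lt_neqAle eq_sym b0 dot_ge0.
(* Weighted AM-GM: since [l * l' = 1 / 4], the product of squares is at most
   [l * x ^+ 4 + l' * y ^+ 4]. The weights are balanced so that each term averages to half of the
   bound. *)
pose l := dot b b / (2 * dot a a); pose l' := dot a a / (2 * dot b b).
have i4 c (k : R) : P.-integrable [set: T] (EFin \o (fun w => k * dot c (xi w) ^+ 4)).
  by apply: integrableM2; [exact: has_moments_cst|exact: has_momentsX].
have E4 c (k : R) : \int[P]_w (k * dot c (xi w) ^+ 4) = k * (3 * dot c c ^+ 2).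
  rewrite RintegralZl//; last exact: (hdot c).2.
  by have [_ _ ->] := gaussian_dot_moments gxi c.
apply: (@le_trans _ _ (\int[P]_w (l * dot a (xi w) ^+ 4 + l' * dot b (xi w) ^+ 4))).
  apply: le_Rintegral => //.
  - by apply: integrableM2; exact: has_momentsX.
  - have := integrableD measurableT (i4 a l) (i4 b l').
    by apply: eq_integrable => // w _.
  - move=> w _; set x := dot a _; set y := dot b _.
    rewrite -subr_ge0 (_ : _ - _ = (dot b b * x ^+ 2 - dot a a * y ^+ 2) ^+ 2 / (2 * dot a a * dot b b)).
      by rewrite divr_ge0 ?sqr_ge0// !mulr_ge0 ?dot_ge0.
    by rewrite /l /l'; field; rewrite !gt_eqF.
rewrite RintegralD// !E4 /l /l' le_eqVlt; apply/orP; left; apply/eqP.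
by field; rewrite !gt_eqF.
Qed.

Lemma quadratic_form_moments :
  [/\ \int[P]_w dot (xi w *m A) (xi w) = \tr A,
      \int[P]_w (dot (xi w *m A) (xi w) ^+ 3) <= 15 * \tr A ^+ 3 &
      forall a, \int[P]_w (dot a (xi w) ^+ 2 * dot (xi w *m A) (xi w)) <= 3 * \tr A * dot a a].
Proof.
have hq := has_moments_quadratic_form.
have [s As'] := psd_sum_rank1 As Apsd.
have E w : dot (xi w *m A) (xi w) = \sum_(b <- s) dot b (xi w) ^+ 2.
  rewrite As'; elim: (s) => [|b s' IHs]; first by rewrite !big_nil mulmx0 dot0l.
  by rewrite !big_cons mulmxDr dotDl dot_rank1 IHs.
have Etr : \tr A = \sum_(b <- s) dot b b.
  rewrite As' raddf_sum /=; apply: eq_bigr => b _; exact: tr_rank1.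
have idot a k : P.-integrable [set: T] (EFin \o (fun w => dot a (xi w) ^+ k)).
  exact: (hdot a).2.
split.
- under eq_Rintegral do rewrite E.
  rewrite Rintegral_sum// Etr; apply: eq_bigr => b _.
  by have [] := gaussian_dot_moments gxi b.
- (* Jensen for the cube with weights |b|^2, in tangent line form. *)
  have [t0|t0] := eqVneq (\tr A) 0.
    have q0 w : dot (xi w *m A) (xi w) = 0.
      rewrite E big_seq big1// => b bs.
      move: t0; rewrite Etr => /eqP; rewrite psumr_eq0 => [/allP/(_ b bs)/eqP|c _]; last exact: dot_ge0.
      by move/dot_eq0 => ->; rewrite dot0l expr0n.
    under eq_Rintegral do rewrite q0 expr0n /=.
    by rewrite Rintegral_cstT t0 expr0n mulr0.
  have {}t0 : 0 < \tr A.
    by rewrite lt_neqAle eq_sym t0 Etr sumr_ge0// => b _; exact: dot_ge0.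
  have i6 b : P.-integrable [set: T] (EFin \o (fun w => dot b (xi w) ^+ 6 / dot b b ^+ 2)).
    by apply: integrableM2; [exact: has_momentsX|exact: has_moments_cst].
  have hS : has_moments P (fun w => \sum_(b <- s) dot b (xi w) ^+ 6 / dot b b ^+ 2).
    by apply: has_moments_sum => b; apply: has_momentsM; [exact: has_momentsX|exact: has_moments_cst].
  apply: (@le_trans _ _ (\int[P]_w (\tr A ^+ 2 * \sum_(b <- s) dot b (xi w) ^+ 6 / dot b b ^+ 2))).
    apply: le_Rintegral => //.
    - exact: hq.2.
    - by apply: integrableM2 => //; exact: has_moments_cst.
    - move=> w _; set q := dot _ _; pose z := q / \tr A.
      have z0 : 0 <= z by rewrite divr_ge0 ?Apsd ?ltW.
      rewrite -ler_pdivrMl ?exprn_gt0//.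
      (* Since [q = z * \tr A], both sides become sums over [s], compared term by term through the
         tangent inequality [3 * z ^+ 2 * y - 2 * z ^+ 3 <= y ^+ 3] for nonnegative [y] and [z]. *)
      rewrite (_ : _ * _ = 3 * z ^+ 2 * q - 2 * z ^+ 3 * \tr A); last first.
        by rewrite /z; field; rewrite gt_eqF.
      rewrite /q E Etr !mulr_sumr -sumrB; apply: ler_sum => b _.
      set p := dot b (xi w); have [b0|b0] := eqVneq (dot b b) 0.
        by rewrite /p (dot_eq0 b0) !dot0l !expr0n /= !(mulr0, mul0r) subr0.
      have {}b0 : 0 < dot b b by rewrite lt_neqAle eq_sym b0 dot_ge0.
      pose y := p ^+ 2 / dot b b.
      have y0 : 0 <= y by rewrite divr_ge0 ?sqr_ge0 ?ltW.
      have Ey : p ^+ 2 = y * dot b b by rewrite /y divfK// gt_eqF.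
      rewrite (exprM p 2 3) Ey.
      rewrite -subr_ge0 (_ : _ - _ = dot b b * ((y - z) ^+ 2 * (y + 2 * z))).
        by apply: mulr_ge0; [exact: ltW|rewrite mulr_ge0 ?sqr_ge0// addr_ge0// mulr_ge0].
      by field; rewrite gt_eqF.
  rewrite RintegralZl//; last exact: has_moments_integrable.
  rewrite Rintegral_sum// [leRHS](_ : _ = \tr A ^+ 2 * \sum_(b <- s) 15 * dot b b); last first.
    by rewrite -mulr_sumr -Etr; ring.
  rewrite ler_wpM2l ?sqr_ge0//; apply: ler_sum => b _.
  rewrite RintegralZr//; have [_ _ _ ->] := gaussian_dot_moments gxi b.
  have [->|b0] := eqVneq (dot b b) 0; first by rewrite [0 ^+ 3]exprS mul0r !mulr0 mul0r.
  by rewrite le_eqVlt; apply/orP; left; apply/eqP; field.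
- move=> a; under eq_Rintegral do rewrite E mulr_sumr.
  rewrite Rintegral_sum => [|b]; last by apply: integrableM2; exact: has_momentsX.
  rewrite Etr mulrAC mulr_sumr; apply: ler_sum => b _.
  exact: Rintegral_dot2_dot2_le.
Qed.

End gaussian_quadratic_form.

(** * Quadratic functions and fresh directions *)

Section quadratic.
Context (R : realType) (n : nat).
Implicit Types (x u v : 'rV[R]_n).

(** For [h != 0] the difference quotient is exactly [l + h * q]. *)
Lemma derive_of_expansion (F : 'rV[R]_n -> R) x v (l q : R) :
  (forall h : R, F (h *: v + x) = F x + h * l + h ^+ 2 * q) -> 'D_v F x = l.
Proof.
move=> FE; rewrite /derive; apply: cvg_lim => //.
have cl : (fun h : R => l + h * q) @ 0^' --> l.
  rewrite -[X in _ --> X]addr0; apply: cvgD; first exact: cvg_cst.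
  rewrite -[X in _ --> X](mul0r q); apply: cvgM; last exact: cvg_cst.
  exact: nbhs_dnbhs.
apply: cvg_trans cl; apply: near_eq_cvg; near=> h.
have h0 : h != 0 by near: h; exact: nbhs_dnbhs_neq.
rewrite /= FE /GRing.scale /=; field.
exact: h0.
Unshelve. all: by end_near. Qed.

Context (M : 'M[R]_n) (b : 'rV[R]_n) (c : R) (f : 'rV[R]_n -> R).
Hypothesis fE : forall x, f x = (x *m M *m x^T) 0 0 + (b *m x^T) 0 0 + c.

Let fdot x : f x = dot (x *m M) x + dot b x + c.
Proof. by rewrite fE !dotE. Qed.

Let slope x v := dot (v *m M) x + dot (x *m M) v + dot b v.

Lemma quadratic_expand (h : R) x v :
  f (h *: v + x) = f x + h * slope x v + h ^+ 2 * dot (v *m M) v.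
Proof.
rewrite !fdot /slope mulmxDl -scalemxAl !(dotDl, dotDr) !(dotZl, dotZr); ring.
Qed.

Lemma derive_quadratic v : 'D_v f = slope ^~ v.
Proof.
by apply/funext => x; apply: derive_of_expansion => h; exact: quadratic_expand.
Qed.

Lemma hessian_quadratic x : hessian f x = M + M^T.
Proof.
apply/matrixP => i j; rewrite !mxE derive_quadratic.
rewrite (@derive_of_expansion _ _ _ (M i j + M j i) 0)// => h.
rewrite /slope mulmxDl -scalemxAl !(dotDl, dotDr) !(dotZl, dotZr).
by rewrite !delta_dot; ring.
Qed.

(** At a minimizer the exact second-order expansion has no linear term, which leaves half of the
    Hessian form. *)
Lemma quadratic_min x0 : (forall v, f x0 <= f v) ->
  psd (M + M^T) /\
  forall v, f v = f x0 + dot ((v - x0) *m (M + M^T)) (v - x0) / 2.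
Proof.
move=> fmin.
have dotMT v : dot (v *m (M + M^T)) v = 2 * dot (v *m M) v.
  by rewrite mulmxDr dotDl [X in _ + X]dot_mulmx trmxK [X in _ + X]dotC; ring.
have ge0 (h : R) v : 0 <= h * slope x0 v + h ^+ 2 * dot (v *m M) v.
  by have := fmin (h *: v + x0); rewrite quadratic_expand -addrA lerDl.
(* Adding the inequalities at [h = 1] and [h = - 1] cancels the slope. *)
have q0 v : 0 <= dot (v *m M) v.
  by have := ge0 1 v; have := ge0 (- 1) v; set l := slope _ _; lra.
split=> [v|v]; first by rewrite dotMT mulr_ge0.
have slope0 : slope x0 (v - x0) = 0.
  set l := slope _ _; have := q0 (v - x0); set q := dot _ _ => q_ge0.
  (* At this step length the increment is [- (l / (q + 1)) ^+ 2], which forces [l = 0]; the added 1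
     keeps the denominator positive when [q = 0]. *)
  have := ge0 (- l / (q + 1)) (v - x0); rewrite -/l -/q.
  have q1 : q + 1 != 0 by rewrite gt_eqF// ltr_wpDl.
  rewrite (_ : _ + _ = - (l / (q + 1)) ^+ 2); last by field.
  rewrite oppr_ge0 => l2; apply/eqP.
  have : (l / (q + 1)) ^+ 2 == 0 by rewrite eq_le l2 sqr_ge0.
  by rewrite sqrf_eq0 mulf_eq0 invr_eq0 (negPf q1) orbF.
rewrite -[v in LHS](subrK x0) -[X in X + x0]scale1r quadratic_expand slope0 dotMT.
by field.
Qed.

End quadratic.

(** * Square integrability and averaging over a fresh direction *)

Section square_integrable.
Context disp (T : measurableType disp) (R : realType) (P : probability T R).

(** Weaker than [has_moments]: in the nontrivial case of the theorem, the iterate is only known to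
    have a finite second moment. *)
Definition square_integrable (X : T -> R) : Prop :=
  measurable_fun [set: T] X /\ P.-integrable [set: T] (fun w => (X w ^+ 2)%:E).

Lemma square_integrableM X Y : square_integrable X -> square_integrable Y ->
  P.-integrable [set: T] (fun w => (X w * Y w)%:E).
Proof.
move=> [mX iX] [mY iY].
apply: (le_integrable measurableT _ _ (integrableD measurableT iX iY)).
  by apply/measurable_EFinP; exact: measurable_funM.
move=> w _; rewrite lee_fin [leRHS]ger0_norm ?addr_ge0 ?sqr_ge0// normrM.
rewrite -(real_normK (num_real (X w))) -(real_normK (num_real (Y w))).
by have := sqr_ge0 (`|X w| - `|Y w|); have := normr_ge0 (X w); have := normr_ge0 (Y w); nra.
Qed.

Lemma square_integrable_lin (I : Type) (s : seq I) (c : I -> R) (X : I -> T -> R) :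
  (forall i, square_integrable (X i)) ->
  square_integrable (fun w => \sum_(i <- s) X i w * c i).
Proof.
move=> hX; split.
  by apply: measurable_sum => i; apply: measurable_funM => //; have [] := hX i.
under eq_fun do rewrite expr2 big_distrlr /=.
apply: integrable_sum_EFin => i; apply: integrable_sum_EFin => j.
have := integrableZl_EFin (c i * c j) (square_integrableM (hX i) (hX j)).
by apply: eq_integrable => // w _ /=; congr EFin; ring.
Qed.

Context (n : nat).

(* A fresh direction xi averages out as if g were deterministic. *)
Lemma fresh_quadratic_le (G H : set (set T)) (g xi : T -> 'rV[R]_n) (phi : T -> R) (c : R) :
  independent_systems P <<s G >> <<s H >> ->
  (forall i, measurable_fun [set: g_sigma_algebraType G] (fun w => g w 0 i)) ->
  (forall i, square_integrable (fun w => g w 0 i)) ->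
  (forall i, measurable_fun [set: g_sigma_algebraType H] (fun w => xi w 0 i)) ->
  measurable_fun [set: g_sigma_algebraType H] phi ->
  (forall i, has_moments P (fun w => xi w 0 i)) -> has_moments P phi ->
  (forall a, \int[P]_w (dot a (xi w) ^+ 2 * phi w) <= c * dot a a) ->
  P.-integrable [set: T] (fun w => (dot (g w) (xi w) ^+ 2 * phi w)%:E) /\
  \int[P]_w (dot (g w) (xi w) ^+ 2 * phi w) <= c * \int[P]_w (dot (g w) (g w)).
Proof.
move=> GH Gg ig Hxi Hphi mxi mphi le_c.
pose Xg (p : 'I_n * 'I_n) w := g w 0 p.1 * g w 0 p.2.
pose Xx (p : 'I_n * 'I_n) w := xi w 0 p.1 * xi w 0 p.2 * phi w.
have iXg p : P.-integrable [set: T] (EFin \o Xg p) by exact: square_integrableM.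
have hXx p : has_moments P (Xx p) by do 2 apply: has_momentsM => //.
have iXx p := has_moments_integrable (hXx p).
(* Expanding over pairs of coordinates separates the factor depending on [g] from the one depending
   on [xi] and [phi]. *)
have expand (u v : 'rV[R]_n) (r : R) : dot u v ^+ 2 * r =
    \sum_(p : 'I_n * 'I_n) (u 0 p.1 * u 0 p.2) * (v 0 p.1 * v 0 p.2 * r).
  rewrite -(pair_big xpredT xpredT (fun i j => (u 0 i * u 0 j) * (v 0 i * v 0 j * r))) /=.
  rewrite expr2 big_distrlr /= mulr_suml; apply: eq_bigr => i _.
  by rewrite mulr_suml; apply: eq_bigr => j _; ring.
have prod p : P.-integrable [set: T] (fun w => (Xg p w * Xx p w)%:E) /\
    \int[P]_w (Xg p w * Xx p w) = (\int[P]_w Xg p w) * (\int[P]_w Xx p w).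
  apply: independent_Rintegral_mul GH _ _ (iXg p) (iXx p).
    exact: measurable_funM.
  by do 2 apply: measurable_funM => //.
have iXgc p (k : R) : P.-integrable [set: T] (EFin \o (fun w => Xg p w * k)).
  by have := integrableZr measurableT k (iXg p); apply: eq_integrable.
split.
  under eq_fun do rewrite expand.
  by apply: integrable_sum_EFin => p; exact: (prod p).1.
have igg : P.-integrable [set: T] (EFin \o (fun w => dot (g w) (g w))).
  by apply: integrable_sum_EFin => i; exact: square_integrableM.
under eq_Rintegral do rewrite expand.
rewrite Rintegral_sum => [|p]; last exact: (prod p).1.
rewrite (eq_bigr (fun p => \int[P]_w (Xg p w * \int[P]_w' Xx p w'))) => [|p _]; last first.
  by rewrite (prod p).2 RintegralZr.
rewrite -Rintegral_sum// -RintegralZl//.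
apply: le_Rintegral => //.
- exact: integrable_sum_EFin.
- exact: integrableZl_EFin.
(* For each fixed [w] the sum over pairs is the integral in [le_c] with the vector frozen at
   [a = g w]. *)
- move=> w _; apply: le_trans (le_c (g w)); rewrite le_eqVlt; apply/orP; left; apply/eqP.
  under [RHS]eq_Rintegral do rewrite expand.
  rewrite Rintegral_sum => [|p]; last exact: (integrableZl_EFin _ (iXx p)).
  by apply: eq_bigr => p _; rewrite RintegralZl//; exact: iXx.
Qed.

End square_integrable.

(** * One step of the algorithm *)

Section algorithm_measurability.
Context disp (T : measurableType disp) (R : realType) (P : probability T R).
Context (d : nat) (f : 'rV[R]_d -> R) (rho delta : R) (h : nat -> R) (x0 : 'rV[R]_d).
Context (oracle : nat -> T -> 'rV[R]_d -> R) (xi x : nat -> T -> 'rV[R]_d).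
Hypothesis x_RG : RG_generated P f rho delta h x0 oracle xi x.

Local Notation y := (fun j w => oracle j w (x j w)).
Local Notation z := (fun j w => oracle j w (x j w + rho *: xi j w)).

(** The generators of [past] before closure, named so that [g_sigma_algebraType] can be formed on
    them. *)
Definition past_events k : set (set T) :=
  \bigcup_(j in [set j : nat | (j < k)%N])
    (vector_events (xi j) `|`
     preimage_set_system [set: T] (y j) measurable `|`
     preimage_set_system [set: T] (z j) measurable).

Lemma measurable_vector_events k i :
  measurable_fun [set: g_sigma_algebraType (vector_events (xi k))] (fun w => xi k w 0 i).
Proof.
by move=> _ U mU; apply: sub_sigma_algebra; exists i => //; exists U.
Qed.

Lemma vector_events_measurable k : vector_events (xi k) `<=` measurable.
Proof. by move=> _ [i _ [U mU <-]]; exact: (RG_gaussian x_RG k).1. Qed.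

Lemma past_events_measurable k : past_events k `<=` measurable.
Proof.
move=> A [j _ [[/vector_events_measurable//|]|]] [U mU <-].
- exact: (RG_answer_base x_RG).
- exact: (RG_answer_shifted x_RG).
Qed.

(** The update is a function of the previous iterate, the direction and the two answers received.
    The answers must belong to the past because they may carry randomness of their own. *)
Lemma measurable_past_iterate k i :
  measurable_fun [set: g_sigma_algebraType (past_events k)] (fun w => x k w 0 i).
Proof.
elim: k i => [|k IHk] i.
  under eq_fun do rewrite (RG_start x_RG).
  exact: measurable_cst.
have sub A : (vector_events (xi k) `|`
     preimage_set_system [set: T] (y k) measurable `|`
     preimage_set_system [set: T] (z k) measurable) A -> <<s past_events k.+1 >> A.
  by move=> ?; apply: sub_sigma_algebra; exists k => //=.
under eq_fun do rewrite (RG_step x_RG) !mxE.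
apply: measurable_funB.
  apply: measurable_fun_generated (IHk i) => A [j /= jk Aj].
  by apply: sub_sigma_algebra; exists j => //=; exact: ltnW.
apply: measurable_funM; last first.
  by move=> _ U mU; apply: sub; left; left; exists i => //; exists U.
apply: measurable_funM; first exact: measurable_cst.
apply: measurable_funM; last exact: measurable_cst.
apply: measurable_funB.
- by move=> _ U mU; apply: sub; right; exists U.
- by move=> _ U mU; apply: sub; left; right; exists U.
Qed.

Lemma measurable_iterate k i : measurable_fun [set: T] (fun w => x k w 0 i).
Proof.
apply: (measurable_fun_generatedT _ (@measurable_past_iterate k i)).
exact: past_events_measurable.
Qed.

Lemma past_fresh k :
  independent_systems P <<s past_events k >> <<s vector_events (xi k) >>.
Proof. exact: (RG_fresh x_RG). Qed.

End algorithm_measurability.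

(** * Deterministic estimates for one step and for the averaging *)

Lemma enorm_sq (R : realType) d (v : 'rV[R]_d) : enorm v ^+ 2 = dot v v.
Proof.
rewrite sqr_sqrtr; first by apply: eq_bigr => i _; rewrite expr2.
by apply: sumr_ge0 => i _; exact: sqr_ge0.
Qed.

Lemma expectation_Rintegral disp (T : measurableType disp) (R : realType)
    (P : probability T R) (X : T -> R) :
  P.-integrable [set: T] (EFin \o X) -> ('E_P[X] = (\int[P]_w X w)%:E)%E.
Proof. by move=> iX; rewrite unlock fineK// integrable_fin_num. Qed.

(** The cross term [s * r] is split by AM-GM with weights 5/8 and 2/5, whose product is 1/4, and
    [(s + r) ^+ 2 <= 2 * s ^+ 2 + 2 * r ^+ 2]. What remains, [3/8 = 1 - 5/8], exceeds the 1/4 that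
    [h ^+ 2 * q] costs on average. *)
Lemma descent_pointwise (R : realType) (h s q r : R) : 0 < h -> 0 <= q ->
  - h * (s + r) * s + (h * (s + r)) ^+ 2 * q / 2 <=
  s ^+ 2 * (h ^+ 2 * q - 3 / 8 * h) + (2 / 5 * h + h ^+ 2 * q) * r ^+ 2.
Proof.
move=> h0 q0.
rewrite -subr_ge0 (_ : _ - _ = h * (5 / 8 * (s + 4 / 5 * r) ^+ 2)
   + h ^+ 2 * q / 2 * (s - r) ^+ 2); last by field.
rewrite addr_ge0// mulr_ge0 ?(ltW h0)//.
- by rewrite mulr_ge0// sqr_ge0.
- by rewrite divr_ge0// mulr_ge0// sqr_ge0.
- exact: sqr_ge0.
Qed.

Lemma error_sq_le (R : realType) (rho delta q e : R) : 0 < rho -> `|e| <= 2 * delta ->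
  (rho * q / 2 + e / rho) ^+ 2 <= rho ^+ 2 * q ^+ 2 / 2 + 8 * (delta ^+ 2 / rho ^+ 2).
Proof.
move=> rho0 e_le.
have e2 : e ^+ 2 <= 4 * delta ^+ 2.
  rewrite -(real_normK (num_real e)) (_ : 4 * _ = (2 * delta) ^+ 2); last by ring.
  by rewrite lerXn2r// nnegrE// (le_trans (normr_ge0 e)).
apply: (@le_trans _ _ (2 * (rho * q / 2) ^+ 2 + 2 * (e / rho) ^+ 2)).
  by rewrite -subr_ge0 (_ : _ - _ = (rho * q / 2 - e / rho) ^+ 2) ?sqr_ge0//; ring.
rewrite (_ : 2 * (rho * q / 2) ^+ 2 = rho ^+ 2 * q ^+ 2 / 2); last by field.
rewrite lerD2l expr_div_n.
have r2 : 0 <= (rho ^+ 2)^-1 by rewrite invr_ge0 sqr_ge0.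
have := ler_wpM2r r2 e2; lra.
Qed.

(* The bound q^2 <= 2 t q + q^3 / (8 t) eliminates the second moment of q, so
   that only E q and E q^3 are needed afterwards. *)
Lemma step_error_le (R : realType) (t rho delta q e h D : R) :
  0 < t -> 0 < rho -> 0 <= q -> `|e| <= 2 * delta ->
  h = 1 / (12 * t) -> D = delta ^+ 2 / rho ^+ 2 ->
  (2 / 5 * h + h ^+ 2 * q) * (rho * q / 2 + e / rho) ^+ 2 <=
  (2 / 5 * h * rho ^+ 2 * t + 8 * h ^+ 2 * D) * q
  + (h * rho ^+ 2 / (40 * t) + h ^+ 2 * rho ^+ 2 / 2) * q ^+ 3 + 16 / 5 * h * D.
Proof.
move=> t0 rho0 q0 e_le hE DE.
have h0 : 0 < h by rewrite hE divr_gt0// mulr_gt0.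
apply: (@le_trans _ _ ((2 / 5 * h + h ^+ 2 * q) * (rho ^+ 2 * q ^+ 2 / 2 + 8 * D))).
  rewrite DE ler_wpM2l ?error_sq_le// addr_ge0// mulr_ge0 ?sqr_ge0//.
  exact: ltW.
(* All terms in [D] cancel; the rest is the bound on [q ^+ 2], whose defect is a square with double
   root [q = 4 * t]. *)
rewrite -subr_ge0 (_ : _ - _ = h * rho ^+ 2 * q / (40 * t) * (q - 4 * t) ^+ 2); last first.
  by field; rewrite gt_eqF.
rewrite mulr_ge0 ?sqr_ge0// divr_ge0 ?mulr_ge0 ?sqr_ge0//; exact: ltW.
Qed.

Lemma step_constants_le (R : realType) (t rho delta h D : R) (d : nat) :
  0 < t -> 0 < rho -> (0 < d)%N ->
  h = 1 / (12 * t) -> D = delta ^+ 2 / rho ^+ 2 ->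
  (2 / 5 * h * rho ^+ 2 * t + 8 * h ^+ 2 * D) * t
  + (h * rho ^+ 2 / (40 * t) + h ^+ 2 * rho ^+ 2 / 2) * (15 * t ^+ 3) + 16 / 5 * h * D <=
  (5 / 16 * t * d%:R + 5 / 384 * t) * rho ^+ 2 + (d%:R / (3 * t) + 1 / (72 * t)) * D.
Proof.
move=> t0 rho0 d0 hE DE.
have d1 : 1 <= d%:R :> R by rewrite ler1n.
have D0 : 0 <= D by rewrite DE divr_ge0 ?sqr_ge0.
(* In these units the left side is [(1/30 + 1/12) * X + (1/18 + 4/15) * Y], and [d >= 1] makes the
   right side larger coefficient by coefficient. *)
pose X := t * rho ^+ 2; pose Y := D / t.
have t_neq0 : t != 0 by rewrite gt_eqF.
have X0 : 0 <= X by rewrite mulr_ge0 ?sqr_ge0 ?ltW.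
have Y0 : 0 <= Y by rewrite divr_ge0// ltW.
have dX := ler_peMl X0 d1; have dY := ler_peMl Y0 d1.
have Ea : (2 / 5 * h * rho ^+ 2 * t + 8 * h ^+ 2 * D) * t = X / 30 + Y / 18.
  by rewrite hE /X /Y; field.
have Eb : (h * rho ^+ 2 / (40 * t) + h ^+ 2 * rho ^+ 2 / 2) * (15 * t ^+ 3) = X / 12.
  by rewrite hE /X; field.
have Ec : 16 / 5 * h * D = 4 / 15 * Y by rewrite hE /Y; field.
have Ed : (5 / 16 * t * d%:R + 5 / 384 * t) * rho ^+ 2 = 5 / 16 * (d%:R * X) + 5 / 384 * X.
  by rewrite /X; ring.
have Ee : (d%:R / (3 * t) + 1 / (72 * t)) * D = (d%:R * Y) / 3 + Y / 72.
  by rewrite /Y; field.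
by rewrite Ea Eb Ec Ed Ee; lra.
Qed.

(* AM-GM on f - f* = <Au, u> / 2. *)
Lemma gap_le (R : realType) d (A : 'M[R]_d) (u : 'rV[R]_d) (t m : R) : 0 < t -> 0 < m ->
  dot (u *m A) u / 2 / m <=
  1 / (96 * t) * dot (u *m A) (u *m A) + 12 * t / m ^+ 2 * dot u u.
Proof.
move=> t0 m0; rewrite /dot !mulr_suml !mulr_sumr -big_split /=.
apply: ler_sum => i _; set a := (u *m A) 0 i; set b := u 0 i.
(* Completing the square uses half of the coefficient [12 * t / m ^+ 2]; the other half stays as
   slack. *)
rewrite -subr_ge0 (_ : _ - _ =
    1 / (96 * t) * (a - 24 * t * b / m) ^+ 2 + 6 * t / m ^+ 2 * b ^+ 2); last first.
  by field; rewrite !gt_eqF.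
by rewrite addr_ge0// mulr_ge0 ?sqr_ge0// divr_ge0 ?mulr_ge0 ?exprn_ge0 ?ltW.
Qed.

Lemma sym_quadD (R : realType) d (A : 'M[R]_d) (u v : 'rV[R]_d) (c : R) : A^T = A ->
  dot ((u + c *: v) *m A) (u + c *: v) =
  dot (u *m A) u + 2 * c * dot (u *m A) v + c ^+ 2 * dot (v *m A) v.
Proof.
move=> As; rewrite mulmxDl -scalemxAl !(dotDl, dotDr) !(dotZl, dotZr).
by rewrite (sym_dot v u As); ring.
Qed.

Lemma descent_step (R : realType) d (f : 'rV[R]_d -> R) (A : 'M[R]_d)
    (xs x xi : 'rV[R]_d) (t rho delta y z h D : R) :
  A^T = A -> psd A ->
  (forall v, f v = f xs + dot ((v - xs) *m A) (v - xs) / 2) ->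
  0 < t -> 0 < rho -> `|y - f x| <= delta -> `|z - f (x + rho *: xi)| <= delta ->
  h = 1 / (12 * t) -> D = delta ^+ 2 / rho ^+ 2 ->
  f (x - (h * ((z - y) / rho)) *: xi) - f xs <=
  (f x - f xs)
  + dot ((x - xs) *m A) xi ^+ 2 * (h ^+ 2 * dot (xi *m A) xi - 3 / 8 * h)
  + ((2 / 5 * h * rho ^+ 2 * t + 8 * h ^+ 2 * D) * dot (xi *m A) xi
     + (h * rho ^+ 2 / (40 * t) + h ^+ 2 * rho ^+ 2 / 2) * dot (xi *m A) xi ^+ 3
     + 16 / 5 * h * D).
Proof.
move=> As Apsd fquad t0 rho0 ye ze hE DE.
have h0 : 0 < h by rewrite hE divr_gt0// mulr_gt0.
set u := x - xs; set s := dot (u *m A) xi; set q := dot (xi *m A) xi.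
pose e := (z - f (x + rho *: xi)) - (y - f x).
have e_le : `|e| <= 2 * delta.
  by apply: le_trans (ler_normB _ _) _; rewrite mulr_natl mulr2n lerD.
have gapE v : f v - f xs = dot ((v - xs) *m A) (v - xs) / 2.
  by rewrite fquad addrC addKr.
have quad v (c : R) : f (x + c *: v) - f xs =
    (f x - f xs) + c * dot (u *m A) v + c ^+ 2 * dot (v *m A) v / 2.
  rewrite !gapE [x + _ - xs]addrAC.
  by rewrite (sym_quadD _ _ _ As) -/u; field.
have fdiff : f (x + rho *: xi) - f x = rho * s + rho ^+ 2 * q / 2.
  rewrite (_ : _ - _ = (f (x + rho *: xi) - f xs) - (f x - f xs)); last by ring.
  by rewrite quad -/s -/q; ring.
(* The deviation of the observed difference quotient from the directional derivative [s]: curvature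
   bias plus the combined error [e] of the two answers. *)
pose r := rho * q / 2 + e / rho.
have oE : (z - y) / rho = s + r.
  rewrite (_ : z - y = f (x + rho *: xi) - f x + e); last by rewrite /e; ring.
  by rewrite fdiff /r; field; rewrite gt_eqF.
rewrite oE -scaleNr quad -/s -/q -!addrA !lerD2l.
have := descent_pointwise s r h0 (Apsd xi); rewrite -/q => H1.
have := step_error_le t0 rho0 (Apsd xi) e_le hE DE; rewrite -/q -/r => H2.
rewrite (_ : _ + _ = - h * (s + r) * s + (h * (s + r)) ^+ 2 * q / 2); last by ring.
by apply: le_trans H1 _; rewrite lerD2l addrA.
Qed.

(** The gain [w * G] pays for [F / m], and multiplying by [m] turns [F - F / m] into [m' * F]. *)
Lemma average_step (R : realType) (F1 F S E G N C w m' m t : R) :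
  m = m' + 1 -> 0 < m ->
  F1 <= F + S + E -> F / m <= w * G + 12 * t / m ^+ 2 * N -> S <= - w * G -> E <= C ->
  m * F1 <= m' * F + m * C + 12 * t / m * N.
Proof.
move=> mE m0 F1_le gap S_le E_le.
have F1_le' : F1 <= F - F / m + 12 * t / m ^+ 2 * N + C.
  rewrite mulNr in S_le.
  by move: (F / m) (12 * t / m ^+ 2 * N) (w * G) gap S_le => a b c; lra.
apply: le_trans (ler_wpM2l (ltW m0) F1_le') _.
rewrite le_eqVlt; apply/orP; left; apply/eqP.
rewrite (_ : m' = m - 1); last by rewrite mE addrK.
by field; rewrite gt_eqF.
Qed.

Section measurable_linear_algebra.
Context disp (T : measurableType disp) (R : realType) (d : nat).

Lemma measurable_dot (u v : T -> 'rV[R]_d) :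
  (forall i, measurable_fun [set: T] (fun w => u w 0 i)) ->
  (forall i, measurable_fun [set: T] (fun w => v w 0 i)) ->
  measurable_fun [set: T] (fun w => dot (u w) (v w)).
Proof. by move=> mu mv; apply: measurable_sum => i; exact: measurable_funM. Qed.

Lemma measurable_mulmx (u : T -> 'rV[R]_d) (A : 'M[R]_d) :
  (forall i, measurable_fun [set: T] (fun w => u w 0 i)) ->
  forall i, measurable_fun [set: T] (fun w => (u w *m A) 0 i).
Proof.
move=> mu i; under eq_fun do rewrite mxE.
by apply: measurable_sum => j; exact: measurable_funM.
Qed.

End measurable_linear_algebra.

Theorem theorem2 (R : realType) (d : nat) (disp : measure_display)
    (T : measurableType disp) (P : probability T R)
    (f : 'rV[R]_d -> R) (L : R) (A : 'M[R]_d) (xs : 'rV[R]_d) (fs : R)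
    (rho delta : R) (h : nat -> R) (x0 : 'rV[R]_d)
    (oracle : nat -> T -> 'rV[R]_d -> R) (xi x : nat -> T -> 'rV[R]_d)
    (C1 C2 : R)
    (f_quadratic : quadratic_function f)
    (f_convex : @convex_function R 'rV[R]_d [set: 'rV[R]_d] f)
    (f_smooth : lipschitz_gradient L f)
    (f_hessian : forall v, hessian f v = A)
    (A_neq0 : A != 0)
    (xs_min : forall v, f xs <= f v)
    (fs_def : fs = f xs)
    (rho_gt0 : 0 < rho)
    (delta_ge0 : 0 <= delta)
    (h_def : forall k, h k = 1 / (12 * \tr A))
    (x_RG : RG_generated P f rho delta h x0 oracle xi x)
    (C1_def : C1 = 5 / 16 * \tr A * d%:R + 5 / 384 * \tr A)
    (C2_def : C2 = d%:R / (3 * \tr A) + 1 / (72 * \tr A)) :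
  forall k : nat,
    (k.+1%:R%:E * ('E_P[fun w => f (x k.+1 w)] - fs%:E) <=
     k%:R%:E * 'E_P[fun w => (f (x k w) - fs)%R]
     + (k.+1%:R * (C1 * rho ^+ 2 + C2 * (delta ^+ 2 / rho ^+ 2)))%:E
     + (12 * \tr A / k.+1%:R)%:E * 'E_P[fun w => (enorm (x k w - xs) ^+ 2)%R])%E.
Proof.
have [M [b [c fE]]] := f_quadratic.
have AE : A = M + M^T by rewrite -(f_hessian 0) (hessian_quadratic fE).
have As : A^T = A by rewrite AE linearD /= trmxK addrC.
have [Apsd fquad] := quadratic_min fE xs_min; rewrite -AE in Apsd fquad.
have t0 : 0 < \tr A by exact: psd_tr_gt0.
(* In dimension 0 every matrix is zero, contrary to [A_neq0]. *)
have d0 : (0 < d)%N.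
  rewrite lt0n; apply: contra_neqN A_neq0 => /eqP d0.
  by apply/matrixP => i; move: (ltn_ord i); rewrite {2}d0.
move=> k.
set t := \tr A in t0 h_def C1_def C2_def *.
pose D := delta ^+ 2 / rho ^+ 2.
pose u j w := x j w - xs.
pose g w := u k w *m A.
pose s w := dot (g w) (xi k w).
pose q w := dot (xi k w *m A) (xi k w).
pose F j w := f (x j w) - fs.
pose N w := enorm (u k w) ^+ 2.
pose hh := 1 / (12 * t).
have h0 : 0 < hh by rewrite divr_gt0// mulr_gt0.
have gxi := RG_gaussian x_RG k.
have FE j w : F j w = dot (u j w *m A) (u j w) / 2.
  by rewrite /F fquad fs_def addrC addKr.
have F0 j w : 0 <= F j w by rewrite FE divr_ge0// Apsd.
have NE w : N w = dot (u k w) (u k w) by exact: enorm_sq.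
have mu j i : measurable_fun [set: T] (fun w => u j w 0 i).
  under eq_fun do rewrite !mxE.
  by apply: measurable_funB => //; exact: (measurable_iterate x_RG).
have mF j : measurable_fun [set: T] (F j).
  rewrite (_ : F j = fun w => dot (u j w *m A) (u j w) / 2); last exact/funext.
  by apply: measurable_funM => //; apply: measurable_dot => //; exact: measurable_mulmx.
have mN : measurable_fun [set: T] N.
  by rewrite (_ : N = fun w => dot (u k w) (u k w)); [exact: measurable_dot|exact/funext].
have EF0 : (0 <= k%:R%:E * 'E_P[fun w => (f (x k w) - fs)%R])%E.
  by apply: mule_ge0; [rewrite lee_fin|apply: expectation_ge0 => w; exact: F0].
have m0 : 0 < k.+1%:R :> R by rewrite ltr0n.
have cN0 : 0 < 12 * t / k.+1%:R by rewrite divr_gt0// mulr_gt0.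
(* If the mean squared distance is infinite, the right side is [+oo], its other terms being
   nonnegative. *)
have [iN|niN] := pselect (P.-integrable [set: T] (EFin \o N)); last first.
  have -> : ('E_P[fun w => (enorm (x k w - xs) ^+ 2)%R] = +oo)%E.
    apply: contra_notP niN => Noo; apply/integrableP; split; first exact/measurable_EFinP.
    under eq_integral do rewrite /= ger0_norm ?sqr_ge0//.
    by rewrite ltey; apply/eqP; rewrite unlock in Noo.
  rewrite gt0_muley ?lte_fin// addey ?leey// gt_eqF// (lt_le_trans (ltNyr 0))//.
  rewrite adde_ge0// lee_fin mulr_ge0// addr_ge0// mulr_ge0 ?sqr_ge0//.
  - by rewrite C1_def addr_ge0// ?mulr_ge0// ltW.
  - by rewrite C2_def addr_ge0// divr_ge0// ?mulr_ge0// ltW.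
  - by rewrite divr_ge0 ?sqr_ge0.
have squ i : square_integrable P (fun w => u k w 0 i).
  split; first exact: mu.
  apply: (le_integrable measurableT _ _ iN) => [|w _].
    by apply/measurable_EFinP; exact: measurable_funX.
  rewrite lee_fin !ger0_norm ?sqr_ge0// NE /dot (bigD1 i)//= -expr2 lerDl.
  by apply: sumr_ge0 => j _; rewrite -expr2 sqr_ge0.
have sqg i : square_integrable P (fun w => g w 0 i).
  by under eq_fun do rewrite mxE; exact: square_integrable_lin.
have hq : has_moments P q by exact: has_moments_quadratic_form.
have [Eq Eq3 Eqa] := quadratic_form_moments gxi As Apsd.
rewrite -/q -/t in Eq Eq3 Eqa.
have hxi i := (gaussian_coord_moments gxi i).1.
(* The coefficient of [s ^+ 2] in [descent_pointwise]; it depends on the fresh direction only. *)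
pose phi w := hh ^+ 2 * q w - 3 / 8 * hh.
have hphi : has_moments P phi.
  apply: (has_momentsD (X := fun w => hh ^+ 2 * q w) (Y := fun=> - (3 / 8 * hh))).
    by apply: has_momentsM => //; exact: has_moments_cst.
  exact: has_moments_cst.
have mxi i : measurable_fun [set: g_sigma_algebraType (vector_events (xi k))]
    (fun w => xi k w 0 i) by exact: measurable_vector_events.
have mphi : measurable_fun [set: g_sigma_algebraType (vector_events (xi k))] phi.
  apply: measurable_funB; last exact: measurable_cst.
  apply: measurable_funM; first exact: measurable_cst.
  apply: (@measurable_dot _ (g_sigma_algebraType (vector_events (xi k)))) => //.
  exact: (@measurable_mulmx _ (g_sigma_algebraType (vector_events (xi k)))).
have phi_le a : \int[P]_w (dot a (xi k w) ^+ 2 * phi w) <= - (1 / (96 * t)) * dot a a.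
  have [hda Eda _ _] := gaussian_dot_moments gxi a.
  have i1 : P.-integrable [set: T] (EFin \o (fun w => dot a (xi k w) ^+ 2 * q w)).
    by apply: has_moments_integrable; apply: has_momentsM => //; exact: has_momentsX.
  have i2 : P.-integrable [set: T] (EFin \o (fun w => dot a (xi k w) ^+ 2)).
    exact: hda.2.
  have E w : dot a (xi k w) ^+ 2 * phi w = hh ^+ 2 * (dot a (xi k w) ^+ 2 * q w)
      + - (3 / 8 * hh) * dot a (xi k w) ^+ 2 by rewrite /phi; ring.
  under eq_Rintegral do rewrite E.
  rewrite RintegralD//; [|exact: integrableZl_EFin|exact: integrableZl_EFin].
  rewrite !RintegralZl// Eda.
  apply: (@le_trans _ _ (hh ^+ 2 * (3 * t * dot a a) + - (3 / 8 * hh) * dot a a)).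
    by rewrite lerD2r ler_wpM2l ?sqr_ge0// Eqa.
  (* With [hh = 1 / (12 * t)], [3 * t * hh ^+ 2 - 3 / 8 * hh = - hh / 8 = - 1 / (96 * t)]. *)
  rewrite le_eqVlt; apply/orP; left; apply/eqP.
  by rewrite /hh; field; rewrite gt_eqF.
have [isp Esp] : P.-integrable [set: T] (fun w => (s w ^+ 2 * phi w)%:E) /\
    \int[P]_w (s w ^+ 2 * phi w) <= - (1 / (96 * t)) * \int[P]_w dot (g w) (g w).
  have GH := past_fresh x_RG (k := k).
  apply: (@fresh_quadratic_le _ _ _ P d _ _ g (xi k) phi _ GH) => //.
  apply: (@measurable_mulmx _ (g_sigma_algebraType (past_events rho oracle xi x k))) => i.
  under eq_fun do rewrite !mxE.
  apply: measurable_funB; last exact: measurable_cst.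
  exact: (measurable_past_iterate x_RG).
(* Coefficients of [q], [q ^+ 3] and 1 in [step_error_le]. *)
pose al := 2 / 5 * hh * rho ^+ 2 * t + 8 * hh ^+ 2 * D.
pose be := hh * rho ^+ 2 / (40 * t) + hh ^+ 2 * rho ^+ 2 / 2.
pose ga := 16 / 5 * hh * D.
have step w : F k.+1 w <= F k w + s w ^+ 2 * phi w + (al * q w + be * q w ^+ 3 + ga).
  rewrite /F (RG_step x_RG) h_def fs_def.
  exact: (descent_step As Apsd fquad t0 rho_gt0
    (RG_oracle x_RG _ _ _) (RG_oracle x_RG _ _ _) (erefl hh) (erefl D)).
have iguu : P.-integrable [set: T] (EFin \o (fun w => dot (g w) (g w))).
  by apply: integrable_sum_EFin => i; exact: square_integrableM.
have iF : P.-integrable [set: T] (EFin \o F k).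
  have : P.-integrable [set: T] (EFin \o (fun w => 2^-1 * dot (g w) (u k w))).
    apply: integrableZl_EFin; apply: integrable_sum_EFin => i.
    exact: square_integrableM.
  by apply: eq_integrable => // w _; rewrite /= FE mulrC.
have iq : P.-integrable [set: T] (EFin \o (fun w => al * q w + be * q w ^+ 3 + ga)).
  apply: has_moments_integrable; apply: has_momentsD; last exact: has_moments_cst.
  by apply: has_momentsD; apply: has_momentsM; try exact: has_moments_cst; [|exact: has_momentsX].
have iFs : P.-integrable [set: T] (EFin \o (fun w => F k w + s w ^+ 2 * phi w)).
  exact: integrableD_EFin.
have iU := integrableD_EFin iFs iq.
(* The next gap lies between 0 and the integrable bound of [step], so it inherits integrability. *)
have iF1 : P.-integrable [set: T] (EFin \o F k.+1).
  apply: (le_integrable measurableT _ _ iU) => [|w _]; first exact/measurable_EFinP.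
  rewrite lee_fin ger0_norm ?F0// ger0_norm ?step//.
  exact: le_trans (F0 _ _) (step w).
have Eerr : \int[P]_w (al * q w + be * q w ^+ 3 + ga) <= C1 * rho ^+ 2 + C2 * D.
  have i1 := integrableZl_EFin al (has_moments_integrable hq).
  have i3 := integrableZl_EFin be (hq.2 3%N).
  rewrite RintegralD//; [|exact: integrableD_EFin|exact: integrable_cst].
  rewrite RintegralD// Rintegral_cstT !RintegralZl//; [|exact: hq.2|exact: has_moments_integrable].
  rewrite Eq C1_def C2_def.
  apply: le_trans (step_constants_le t0 rho_gt0 d0 (erefl hh) (erefl D)).
  rewrite -/al -/be -/ga lerD2r lerD2l ler_wpM2l//.
  by apply: addr_ge0; apply: divr_ge0 => //; apply: mulr_ge0 => //; rewrite ?sqr_ge0// ltW.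
have E1 : \int[P]_w F k.+1 w <= \int[P]_w F k w + \int[P]_w (s w ^+ 2 * phi w)
    + \int[P]_w (al * q w + be * q w ^+ 3 + ga).
  by rewrite -!RintegralD//; apply: le_Rintegral.
have gap : (\int[P]_w F k w) / k.+1%:R <=
    1 / (96 * t) * (\int[P]_w dot (g w) (g w)) + 12 * t / k.+1%:R ^+ 2 * \int[P]_w N w.
  rewrite -RintegralZr// -!RintegralZl// -RintegralD//; last 2 first.
  - exact: integrableZl_EFin.
  - exact: integrableZl_EFin.
  apply: le_Rintegral => //.
  - have := integrableZl_EFin (k.+1%:R^-1) iF.
    by apply: eq_integrable => // w _; rewrite /= mulrC.
  - by apply: integrableD_EFin; exact: integrableZl_EFin.
  - by move=> w _; rewrite FE NE; exact: gap_le.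
(* Here [fs] stands outside the expectation; finiteness of the gap's mean allows it to be moved
   inside. *)
have -> : ('E_P[fun w => f (x k.+1 w)] = (\int[P]_w F k.+1 w + fs)%:E)%E.
  have Ef w : f (x k.+1 w) = F k.+1 w + fs by rewrite /F subrK.
  have -> : (fun w => f (x k.+1 w)) = (fun w => F k.+1 w + fs) by apply/funext.
  rewrite expectation_Rintegral; last first.
    by apply: integrableD_EFin => //; exact: integrable_cst.
  by rewrite RintegralD// ?Rintegral_cstT//; exact: integrable_cst.
rewrite (expectation_Rintegral iF) (expectation_Rintegral iN).
rewrite -EFinB -!EFinM -!EFinD lee_fin addrK.
by apply: (average_step _ m0 E1 gap Esp Eerr); rewrite natr1.
Qed.
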